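(* Let $\mathfrak{g}=\mathfrak{sl}(2)$, let $\omega_1$ be the highest weight of the standard representation $\mathbb{C}^2$, and $\vec\lambda=(\omega_1,\omega_1,\omega_1,\omega_1)$. Then the monodromy representation of the Knizhnik–Zamolodchikov connection with $\kappa=3$ on the (trivial, rank two) bundle with fibre the space of coinvariants $\mathbb{A}(\vec\lambda)$, over the configuration space of $4$ distinct points in $\mathbb{A}^1=\mathbb{C}$, is not semisimple.
   Context: $\mathbb{A}(\vec\lambda)=(\mathbb{C}^2)^{\otimes4}/\mathfrak{sl}(2)\cdot(\mathbb{C}^2)^{\otimes4}$, of dimension two. Let $\Omega=\frac12h\otimes h+e\otimes f+f\otimes e$ and let $\Omega_{jk}$ be the operator on $(\mathbb{C}^2)^{\otimes4}$ given by $\Omega$ acting in the $j$-th and $k$-th tensor factors; these operators descend to $\mathbb{A}(\vec\lambda)$. Over the space of $(z_1,\dots,z_4)\in\mathbb{C}^4$ with distinct coordinates, a local section $u$ of $\mathbb{A}(\vec\lambda)\otimes\mathcal{O}$ is flat for the KZ connection with parameter $\kappa$ if $$\Big(\frac{\partial}{\partial z_j}+\frac1\kappa\sum_{k\ne j}\frac{\Omega_{jk}}{z_j-z_k}\Big)u=0,\qquad j=1,\dots,4.$$ The monodromy representation is the associated representation of the fundamental group of this configuration space. *)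

(* Defs.v *)
From HB Require Import structures.
From mathcomp Require Import all_boot all_order all_algebra generic_quotient.
From mathcomp Require Import all_classical all_reals all_analysis.
From mathcomp Require Import mxtens complex.
From mathcomp Require Import ring lra.

Set Implicit Arguments.
Unset Strict Implicit.
Unset Printing Implicit Defensive.

Import Order.TTheory GRing.Theory Num.Theory.
Import numFieldNormedType.Exports.

Local Open Scope classical_set_scope.
Local Open Scope ring_scope.
Local Open Scope quotient_scope.

(* Packaging R[i] as a [numClosedFieldType] gives access to the topological and
   normed structures that the library attaches to that interface. *)
Definition Cx (R : realType) : numClosedFieldType := R[i].

Lemma within_continuous_comp (T U V : topologicalType) (A : set T) (B : set U)
    (g : U -> V) (f : T -> U) :
  (forall x, A x -> B (f x)) ->
  {within A, continuous f} -> {within B, continuous g} ->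
  {within A, continuous (g \o f)}.
Proof.
move=> AB /subspace_continuousP cf /subspace_continuousP cg.
apply/subspace_continuousP => x Ax.
apply: cvg_comp (cg _ (AB x Ax)).
move=> P /= /(cf x Ax) h.
rewrite /nbhs /= /within /= in h *.
by near=> y => Ay; apply: (near h y) => //; exact: AB.
Unshelve. all: by end_near. Qed.

Lemma within_continuous_glue (R : realType) (S T : topologicalType) (D : set S)
    (p : S -> R) (c : R) (f g : S -> T) :
  closed D -> continuous p ->
  {within D `&` [set x | p x <= c], continuous f} ->
  {within D `&` [set x | c <= p x], continuous g} ->
  (forall x, D x -> p x = c -> f x = g x) ->
  {within D, continuous (fun x => if p x <= c then f x else g x)}.
Proof.
move=> clD cp cf cg fg.
have -> : D = (D `&` [set x | p x <= c]) `|` (D `&` [set x | c <= p x]).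
  rewrite -setIUr; apply/seteqP; split=> [x Dx|x []//]; split=> //=.
  by have [h|/ltW h] := leP (p x) c; [left|right].
apply: withinU_continuous.
- apply: closedI => //.
  apply: (closed_comp (f := p) (D := [set r | r <= c])) => [x _|]; first exact: cp.
  exact: closed_le.
- apply: closedI => //.
  apply: (closed_comp (f := p) (D := [set r | c <= r])) => [x _|]; first exact: cp.
  exact: closed_ge.
- have h : {in D `&` [set x | p x <= c],
      f =1 (fun x => if p x <= c then f x else g x)}.
    by move=> x /set_mem[_ /= ->].
  exact: subspace_eq_continuous h cf.
- have h : {in D `&` [set x | c <= p x],
      g =1 (fun x => if p x <= c then f x else g x)}.
    move=> x /set_mem[Dx /= cx].
    by case: leP => // xc; rewrite fg //; apply/eqP; rewrite eq_le xc cx.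
  exact: subspace_eq_continuous h cg.
Qed.

Lemma continuous_pair (S U V : topologicalType) (f : S -> U) (g : S -> V) :
  continuous f -> continuous g -> continuous (fun x => (f x, g x)).
Proof. by move=> cf cg x; apply: cvg_pair; [exact: cf|exact: cg]. Qed.

Section Pi1.
Context {R : realType} {T : topologicalType} (A : set T) (x0 : T).

(* A loop is a function on R of which only the restriction to [0, 1] matters:
   nothing is required of it elsewhere, and [homotopic] ignores its values
   elsewhere. *)
Record loop := Loop {
  loop_fun :> R -> T;
  loop_cts : {within `[0, 1], continuous loop_fun};
  loop_in : forall t : R, t \in `[0, 1] -> A (loop_fun t);
  loop0 : loop_fun 0 = x0;
  loop1 : loop_fun 1 = x0 }.

HB.instance Definition _ := gen_eqMixin loop.
HB.instance Definition _ := gen_choiceMixin loop.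

Definition homotopic (a b : loop) : Prop :=
  exists H : R * R -> T,
    [/\ {within `[0, 1] `*` `[0, 1], continuous H},
        (forall s t : R, s \in `[0, 1] -> t \in `[0, 1] -> A (H (s, t))),
        (forall t : R, t \in `[0, 1] -> H (0, t) = a t),
        (forall t : R, t \in `[0, 1] -> H (1, t) = b t) &
        (forall s : R, s \in `[0, 1] -> H (s, 0) = x0 /\ H (s, 1) = x0)].

Let I01 : set R := `[0, 1].
Let square : set (R * R) := `[0, 1] `*` `[0, 1].

Let closed_square : closed square.
Proof.
have -> : square = (fst @^-1` `[0, 1]) `&` (snd @^-1` `[0, 1]) by [].
by apply: closedI; apply: closed_comp => [p _|];
  try exact: interval_closed; [exact: cvg_fst|exact: cvg_snd].
Qed.

Lemma homotopic_reparam (c a b : loop) (phi psi : R -> R) :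
  continuous phi -> continuous psi ->
  (forall t : R, t \in `[0, 1] -> phi t \in `[0, 1]) ->
  (forall t : R, t \in `[0, 1] -> psi t \in `[0, 1]) ->
  phi 0 = psi 0 -> phi 1 = psi 1 ->
  (forall t : R, t \in `[0, 1] -> a t = c (phi t)) ->
  (forall t : R, t \in `[0, 1] -> b t = c (psi t)) -> homotopic a b.
Proof.
move=> cphi cpsi Iphi Ipsi e0 e1 aE bE.
pose h (p : R * R) : R := (1 - p.1) * phi p.2 + p.1 * psi p.2.
have hI s t : s \in `[0, 1] -> t \in `[0, 1] -> h (s, t) \in `[0, 1].
  move=> hs ht; have := Iphi t ht; have := Ipsi t ht; move: hs.
  rewrite !in_itv /= /h /= => /andP[s0 s1] /andP[p0 p1] /andP[q0 q1].
  by apply/andP; split; nra.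
have ch : continuous h.
  move=> p; apply: cvgD; apply: cvgM.
  - by apply: cvgB; [exact: cvg_cst|exact: cvg_fst].
  - by apply: continuous_comp; [exact: cvg_snd|exact: cphi].
  - exact: cvg_fst.
  - by apply: continuous_comp; [exact: cvg_snd|exact: cpsi].
exists (c \o h); split.
- apply: (within_continuous_comp (B := I01) (f := h) _ _ (@loop_cts c)).
    by move=> [s t] [hs ht]; exact: hI.
  exact: continuous_subspaceT.
- by move=> s t hs ht; apply: loop_in; exact: hI.
- by move=> t ht; rewrite /= /h /= subr0 mul1r mul0r addr0 aE.
- by move=> t ht; rewrite /= /h /= subrr mul1r mul0r add0r bE.
- move=> s _; rewrite /= /h /= e0 e1.
  have e (x : R) : (1 - s) * x + s * x = x by rewrite -mulrDl subrK mul1r.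
  rewrite !e -bE ?in_itv /= ?lexx ?ler01 // -bE ?in_itv /= ?lexx ?ler01 //.
  by rewrite loop0 loop1.
Qed.

Let cfst : continuous (fst : R * R -> R). Proof. by move=> p; exact: cvg_fst. Qed.
Let csnd : continuous (snd : R * R -> R). Proof. by move=> p; exact: cvg_snd. Qed.

Let cvg_1B (S : topologicalType) (p : S -> R) :
  continuous p -> continuous (fun x => 1 - p x).
Proof. by move=> cp x; apply: cvgB; [exact: cvg_cst|exact: cp]. Qed.

Let homotopic_refl a : homotopic a a.
Proof. by apply: (@homotopic_reparam a a a id id) => // x; exact: cvg_id. Qed.

Let homotopic_sym a b : homotopic a b -> homotopic b a.
Proof.
move=> [H [cH AH H0 H1 He]].
have i1 (s : R) : s \in `[0, 1] -> 1 - s \in `[0, 1].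
  by rewrite !in_itv /= => /andP[? ?]; apply/andP; split; lra.
exists (fun p => H (1 - p.1, p.2)); split.
- apply: (within_continuous_comp (B := square)
    (f := fun p : R * R => (1 - p.1, p.2)) _ _ cH).
    by move=> [s t] [hs ht]; split => //=; exact: i1.
  by apply: continuous_subspaceT; apply: continuous_pair => //; exact: cvg_1B.
- by move=> s t /i1 hs ht; exact: AH.
- by move=> t ht; rewrite /= subr0 H1.
- by move=> t ht; rewrite /= subrr H0.
- by move=> s /i1 /He.
Qed.

Let inhalf1 (s : R) : s \in `[0, 1] -> s <= 2^-1 -> 2 * s \in `[0, 1].
Proof. by rewrite !in_itv /= => /andP[? ?] ?; apply/andP; split; lra. Qed.

Let inhalf2 (s : R) : s \in `[0, 1] -> 2^-1 <= s -> 2 * s - 1 \in `[0, 1].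
Proof. by rewrite !in_itv /= => /andP[? ?] ?; apply/andP; split; lra. Qed.

Let cvg_2 (S : topologicalType) (p : S -> R) :
  continuous p -> continuous (fun x => 2 * p x).
Proof. by move=> cp x; apply: cvgM; [exact: cvg_cst|exact: cp]. Qed.

Let cvg_21 (S : topologicalType) (p : S -> R) :
  continuous p -> continuous (fun x => 2 * p x - 1).
Proof. by move=> cp x; apply: cvgB; [exact: cvg_2|exact: cvg_cst]. Qed.


Let E0 : 0 \in `[0, 1 : R]. Proof. by rewrite in_itv /= lexx ler01. Qed.
Let E1 : 1 \in `[0, 1 : R]. Proof. by rewrite in_itv /= lexx ler01. Qed.
Let half0 : (0 : R) <= 2^-1. Proof. by rewrite invr_ge0. Qed.
Let half1 : (1 <= 2^-1 :> R) = false. Proof. by apply/negbTE; rewrite -ltNge; lra. Qed.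
Let two_half : 2 * 2^-1 = 1 :> R. Proof. by rewrite divff. Qed.
Let two1 : 2 - 1 = 1 :> R. Proof. by lra. Qed.

Let homotopic_trans a b c : homotopic a b -> homotopic b c -> homotopic a c.
Proof.
move=> [H [cH AH H0 H1 He]] [K [cK AK K0 K1 Ke]].
exists (fun p => if p.1 <= 2^-1 then H (2 * p.1, p.2) else K (2 * p.1 - 1, p.2)).
split.
- apply: within_continuous_glue => //.
  + apply: (within_continuous_comp (B := square)
      (f := fun p : R * R => (2 * p.1, p.2)) _ _ cH).
      by move=> [s t] [[hs ht] /= h]; split=> //=; exact: inhalf1.
    by apply: continuous_subspaceT; apply: continuous_pair => //; exact: cvg_2.
  + apply: (within_continuous_comp (B := square)
      (f := fun p : R * R => (2 * p.1 - 1, p.2)) _ _ cK).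
      by move=> [s t] [[hs ht] /= h]; split=> //=; exact: inhalf2.
    by apply: continuous_subspaceT; apply: continuous_pair => //; exact: cvg_21.
  + by move=> [s t] [hs ht] /= ->; rewrite two_half subrr H1 // K0.
- move=> s t hs ht /=; case: leP => h; first by apply: AH => //; exact: inhalf1.
  by apply: AK => //; apply: inhalf2 => //; exact: ltW.
- by move=> t ht /=; rewrite half0 mulr0 H0.
- by move=> t ht /=; rewrite half1 mulr1 two1 K1.
- move=> s hs /=; case: leP => h; first exact/He/inhalf1.
  by apply: Ke; apply: inhalf2 => //; exact: ltW.
Qed.

Definition homotopicb (a b : loop) : bool := `[< homotopic a b >].

Let homotopicb_refl : reflexive homotopicb.
Proof. by move=> a; exact/asboolP. Qed.

Let homotopicb_sym : symmetric homotopicb.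
Proof. by move=> a b; apply/asboolP/asboolP; exact: homotopic_sym. Qed.

Let homotopicb_trans : transitive homotopicb.
Proof. by move=> b a c /asboolP ab /asboolP; move/(homotopic_trans ab)/asboolP. Qed.

Canonical homotopic_equiv :=
  EquivRel homotopicb homotopicb_refl homotopicb_sym homotopicb_trans.

Let concat_fun (a b : R -> T) (t : R) : T :=
  if t <= 2^-1 then a (2 * t) else b (2 * t - 1).

Let concat_cts (a b : loop) : {within `[0, 1], continuous (concat_fun a b)}.
Proof.
apply: (within_continuous_glue (p := id)).
- exact: interval_closed.
- by move=> x; exact: cvg_id.
- apply: (within_continuous_comp (B := I01)
    (f := fun t : R => 2 * t) _ _ (@loop_cts a)).
    by move=> t [ht /= h]; exact: inhalf1.
  by apply: continuous_subspaceT; apply: cvg_2 => x; exact: cvg_id.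
- apply: (within_continuous_comp (B := I01)
    (f := fun t : R => 2 * t - 1) _ _ (@loop_cts b)).
    by move=> t [ht /= h]; exact: inhalf2.
  by apply: continuous_subspaceT; apply: cvg_21 => x; exact: cvg_id.
- by move=> t _ ->; rewrite two_half subrr loop0 loop1.
Qed.

Let concat_in (a b : loop) (t : R) : t \in `[0, 1] -> A (concat_fun a b t).
Proof.
move=> ht; rewrite /concat_fun; case: leP => h; apply: loop_in.
  exact: inhalf1.
by apply: inhalf2 => //; exact: ltW.
Qed.

Let concat0 (a b : loop) : concat_fun a b 0 = x0.
Proof. by rewrite /concat_fun half0 mulr0 loop0. Qed.

Let concat1 (a b : loop) : concat_fun a b 1 = x0.
Proof. by rewrite /concat_fun half1 mulr1 two1 loop1. Qed.

(* [a] first, then [b]. *)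
Definition loop_concat (a b : loop) : loop :=
  @Loop (fun t => if t <= 2^-1 then a (2 * t) else b (2 * t - 1))
    (@concat_cts a b) (concat_in a b) (concat0 a b) (concat1 a b).

Let in1B (t : R) : t \in `[0, 1] -> 1 - t \in `[0, 1].
Proof. by rewrite !in_itv /= => /andP[? ?]; apply/andP; split; lra. Qed.

Let rev_cts (a : loop) : {within `[0, 1], continuous (fun t => a (1 - t))}.
Proof.
apply: (within_continuous_comp (B := I01)
  (f := fun t : R => 1 - t) _ _ (@loop_cts a)).
  by move=> t; exact: in1B.
apply: continuous_subspaceT => t.
by apply: cvgB; [exact: cvg_cst|exact: cvg_id].
Qed.

Let rev0 (a : loop) : a (1 - 0) = x0. Proof. by rewrite subr0 loop1. Qed.
Let rev1 (a : loop) : a (1 - 1) = x0. Proof. by rewrite subrr loop0. Qed.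

Definition loop_rev (a : loop) : loop :=
  @Loop (fun t => a (1 - t)) (@rev_cts a)
    (fun t ht => loop_in a (in1B ht)) (rev0 a) (rev1 a).

Let cst_cts : {within `[0, 1], continuous (fun _ : R => x0)}.
Proof. by apply: continuous_subspaceT => t; exact: cvg_cst. Qed.

Definition loop_cst (Ax0 : A x0) : loop :=
  @Loop (fun=> x0) (@cst_cts) (fun _ _ => Ax0) erefl erefl.

Lemma homotopic_concat a a' b b' : homotopic a a' -> homotopic b b' ->
  homotopic (loop_concat a b) (loop_concat a' b').
Proof.
move=> [H [cH AH H0 H1 He]] [K [cK AK K0 K1 Ke]].
exists (fun p => if p.2 <= 2^-1 then H (p.1, 2 * p.2) else K (p.1, 2 * p.2 - 1)).
split.
- apply: within_continuous_glue => //.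
  + apply: (within_continuous_comp (B := square)
      (f := fun p : R * R => (p.1, 2 * p.2)) _ _ cH).
      by move=> [s t] [[hs ht] /= h]; split=> //=; exact: inhalf1.
    by apply: continuous_subspaceT; apply: continuous_pair => //; exact: cvg_2.
  + apply: (within_continuous_comp (B := square)
      (f := fun p : R * R => (p.1, 2 * p.2 - 1)) _ _ cK).
      by move=> [s t] [[hs ht] /= h]; split=> //=; exact: inhalf2.
    by apply: continuous_subspaceT; apply: continuous_pair => //; exact: cvg_21.
  + move=> [s t] [hs ht] /= ->; rewrite two_half subrr.
    by rewrite (proj2 (He s hs)) (proj1 (Ke s hs)).
- move=> s t hs ht /=; case: leP => h; first by apply: AH => //; exact: inhalf1.
  by apply: AK => //; apply: inhalf2 => //; exact: ltW.
- move=> t ht /=; case: leP => h; first by rewrite H0 //; exact: inhalf1.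
  by rewrite K0 //; apply: inhalf2 => //; exact: ltW.
- move=> t ht /=; case: leP => h; first by rewrite H1 //; exact: inhalf1.
  by rewrite K1 //; apply: inhalf2 => //; exact: ltW.
- move=> s hs /=; rewrite half0 half1 mulr0 mulr1 two1.
  by rewrite (proj1 (He s hs)) (proj2 (Ke s hs)).
Qed.

Lemma homotopic_rev a b : homotopic a b -> homotopic (loop_rev a) (loop_rev b).
Proof.
move=> [H [cH AH H0 H1 He]].
exists (fun p => H (p.1, 1 - p.2)); split.
- apply: (within_continuous_comp (B := square)
    (f := fun p : R * R => (p.1, 1 - p.2)) _ _ cH).
    by move=> [s t] [hs ht]; split => //=; exact: in1B.
  by apply: continuous_subspaceT; apply: continuous_pair => //; exact: cvg_1B.
- by move=> s t hs /in1B ht; exact: AH.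
- by move=> t /in1B /H0.
- by move=> t /in1B /H1.
- by move=> s /He[h0 h1]; rewrite subr0 subrr.
Qed.

Let cvg_affine (u v : R) : continuous (fun t : R => u * t + v).
Proof.
move=> t; apply: cvgD; last exact: cvg_cst.
by apply: cvgM; [exact: cvg_cst|exact: cvg_id].
Qed.

Let cvg_min (f g : R -> R) : continuous f -> continuous g ->
  continuous (fun t => Num.min (f t) (g t)).
Proof. by move=> cf cg t; apply: continuous_min; [exact: cf|exact: cg]. Qed.

Let cvg_max (f g : R -> R) : continuous f -> continuous g ->
  continuous (fun t => Num.max (f t) (g t)).
Proof. by move=> cf cg t; apply: continuous_max; [exact: cf|exact: cg]. Qed.

Lemma homotopic_concatA a b c :
  homotopic (loop_concat a (loop_concat b c)) (loop_concat (loop_concat a b) c).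
Proof.
pose phi (t : R) : R :=
  Num.min (2 * t + 0) (Num.min (1 * t + 4^-1) (2^-1 * t + 2^-1)).
have phi1 t : t <= 4^-1 -> phi t = 2 * t.
  by move=> ?; rewrite /phi [Num.min (_ + _) _]min_l ?min_l; lra.
have phi2 t : 4^-1 <= t -> t <= 2^-1 -> phi t = t + 4^-1.
  by move=> ? ?; rewrite /phi [Num.min (1 * _ + _) _]min_l ?min_r; lra.
have phi3 t : 2^-1 <= t -> phi t = 2^-1 * t + 2^-1.
  by move=> ?; rewrite /phi [Num.min (1 * _ + _) _]min_r ?min_r; lra.
apply: (@homotopic_reparam (loop_concat a (loop_concat b c)) _ _ id phi) => //.
- by move=> x; exact: cvg_id.
- by apply: cvg_min; [|apply: cvg_min]; exact: cvg_affine.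
- move=> t; rewrite !in_itv /= => /andP[t0 t1].
  have [h|h] := leP t 4^-1; first by rewrite phi1 //; apply/andP; split; lra.
  have [k|k] := leP t 2^-1.
    by rewrite phi2 //; [apply/andP; split; lra|exact: ltW].
  by rewrite phi3; [apply/andP; split; lra|exact: ltW].
- by rewrite phi1 ?mulr0 // invr_ge0.
- by rewrite phi3; lra.
move=> t; rewrite in_itv /= => /andP[t0 t1].
have [k|k] := leP t 2^-1.
  have [h|h] := leP (2 * t) 2^-1.
    rewrite phi1; last lra.
    by rewrite h.
  rewrite phi2 ?k; [|lra|lra].
  case: leP => g; first by exfalso; lra.
  have -> : (2 * (t + 4^-1) - 1 <= 2^-1) by lra.
  by congr (b _); lra.
rewrite phi3; last lra.
case: leP => g; first by exfalso; lra.
case: leP => g'; first by exfalso; lra.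
by congr (c _); lra.
Qed.

Lemma homotopic_concat1l (Ax0 : A x0) a :
  homotopic (loop_concat (loop_cst Ax0) a) a.
Proof.
apply: (@homotopic_reparam a _ _ (fun t => Num.max 0 (2 * t + -1)) id) => //.
- by apply: cvg_max; [move=> x; exact: cvg_cst|exact: cvg_affine].
- by move=> x; exact: cvg_id.
- move=> t; rewrite !in_itv /= => /andP[t0 t1].
  by rewrite le_max ge_max; apply/andP; split; [|apply/andP; split]; lra.
- by rewrite max_l //; lra.
- by rewrite max_r //; lra.
- move=> t _ /=; case: leP => h; first by rewrite max_l ?loop0 //; lra.
  by rewrite max_r //; lra.
Qed.

Lemma homotopic_concat1r (Ax0 : A x0) a :
  homotopic (loop_concat a (loop_cst Ax0)) a.
Proof.
apply: (@homotopic_reparam a _ _ (fun t => Num.min (2 * t + 0) 1) id) => //.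
- by apply: cvg_min; [exact: cvg_affine|move=> x; exact: cvg_cst].
- by move=> x; exact: cvg_id.
- move=> t; rewrite !in_itv /= => /andP[t0 t1].
  by rewrite le_min ge_min; apply/andP; split; [apply/andP; split|]; lra.
- by rewrite min_l //; lra.
- by rewrite min_r //; lra.
- move=> t _ /=; case: leP => h; first by rewrite min_l ?addr0 //; lra.
  by rewrite min_r ?loop1 //; lra.
Qed.

Lemma homotopic_concatVl (Ax0 : A x0) a :
  homotopic (loop_concat (loop_rev a) a) (loop_cst Ax0).
Proof.
apply: (@homotopic_reparam a _ _
  (fun t => Num.max (- 2 * t + 1) (2 * t + -1)) (fun=> 1)) => //.
- by apply: cvg_max; exact: cvg_affine.
- by move=> x; exact: cvg_cst.
- move=> t; rewrite !in_itv /= => /andP[t0 t1]; rewrite le_max ge_max.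
  apply/andP; split; last by apply/andP; split; lra.
  by have [h|h] := leP t 2^-1; apply/orP; [left|right]; lra.
- by rewrite max_l //; lra.
- by rewrite max_r //; lra.
- move=> t _ /=; case: leP => h; last by rewrite max_r //; lra.
  by rewrite max_l; [congr (a _)|]; lra.
- by move=> t _ /=; rewrite loop1.
Qed.

Lemma homotopic_concatVr (Ax0 : A x0) a :
  homotopic (loop_concat a (loop_rev a)) (loop_cst Ax0).
Proof.
apply: (@homotopic_reparam a _ _
  (fun t => Num.min (2 * t + 0) (- 2 * t + 2)) (fun=> 0)) => //.
- by apply: cvg_min; exact: cvg_affine.
- by move=> x; exact: cvg_cst.
- move=> t; rewrite !in_itv /= => /andP[t0 t1]; rewrite le_min ge_min.
  apply/andP; split; first by apply/andP; split; lra.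
  by have [h|h] := leP t 2^-1; apply/orP; [left|right]; lra.
- by rewrite min_l //; lra.
- by rewrite min_r //; lra.
- move=> t _ /=; case: leP => h; first by rewrite min_l ?addr0 //; lra.
  by rewrite min_r; [congr (a _)|]; lra.
- by move=> t _ /=; rewrite loop0.
Qed.

(* The type depends on the proof that the base point lies in [A] so that the
   group structure, whose unit is the constant loop, can be inferred. *)
Definition pi1 (Ax0 : A x0) := {eq_quot homotopic_equiv}.

HB.instance Definition _ (Ax0 : A x0) := Choice.on (pi1 Ax0).
HB.instance Definition _ (Ax0 : A x0) := Quotient.on (pi1 Ax0).
HB.instance Definition _ (Ax0 : A x0) := EqQuotient.on (pi1 Ax0).

Section Group.
Variable Ax0 : A x0.

Definition pi1_class (a : loop) : pi1 Ax0 := \pi_(pi1 Ax0) a.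

Lemma pi1_classP a b : pi1_class a = pi1_class b <-> homotopic a b.
Proof.
split=> [/eqmodP/asboolP //|ab]; exact/eqmodP/asboolP.
Qed.

Let pi1_classK (x : pi1 Ax0) : pi1_class (repr x) = x.
Proof. exact: reprK. Qed.

Let repr_class a : homotopic (repr (pi1_class a)) a.
Proof. by apply/pi1_classP; rewrite pi1_classK. Qed.

Definition pi1_one : pi1 Ax0 := pi1_class (loop_cst Ax0).
Definition pi1_mul (x y : pi1 Ax0) : pi1 Ax0 :=
  pi1_class (loop_concat (repr x) (repr y)).
Definition pi1_inv (x : pi1 Ax0) : pi1 Ax0 := pi1_class (loop_rev (repr x)).

Let mul_class a b :
  pi1_mul (pi1_class a) (pi1_class b) = pi1_class (loop_concat a b).
Proof. by apply/pi1_classP/homotopic_concat; exact: repr_class. Qed.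

Let pi1_mulA : associative pi1_mul.
Proof.
move=> x y z; rewrite -(pi1_classK x) -(pi1_classK y) -(pi1_classK z).
by rewrite !mul_class; apply/pi1_classP; exact: homotopic_concatA.
Qed.

Let pi1_mul1 : left_id pi1_one pi1_mul.
Proof.
move=> x; rewrite -(pi1_classK x) mul_class.
by apply/pi1_classP; exact: homotopic_concat1l.
Qed.

Let pi1_mulr1 : right_id pi1_one pi1_mul.
Proof.
move=> x; rewrite -(pi1_classK x) mul_class.
by apply/pi1_classP; exact: homotopic_concat1r.
Qed.

Let pi1_mulV : left_inverse pi1_one pi1_inv pi1_mul.
Proof.
move=> x; rewrite /pi1_inv -[X in pi1_mul _ X]pi1_classK mul_class.
by apply/pi1_classP; exact: homotopic_concatVl.
Qed.

Let pi1_mulrV : right_inverse pi1_one pi1_inv pi1_mul.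
Proof.
move=> x; rewrite /pi1_inv -[X in pi1_mul X _]pi1_classK mul_class.
by apply/pi1_classP; exact: homotopic_concatVr.
Qed.

HB.instance Definition _ := isGroup.Build (pi1 Ax0)
  pi1_mulA pi1_mul1 pi1_mulr1 pi1_mulV pi1_mulrV.

Lemma pi1_classM a b :
  pi1_class (loop_concat a b) = (pi1_class a * pi1_class b)%g.
Proof. by rewrite -mul_class. Qed.

End Group.
End Pi1.

Section Representations.
Context {F : fieldType} {G : groupType} {n : nat} (rho : G -> 'M[F]_n).

Definition is_representation : Prop :=
  rho 1%g = 1%:M /\ (forall x y, rho (x * y)%g = rho x *m rho y).

(* Subspaces are row spaces of matrices. *)
Definition subrepresentation (U : 'M[F]_n) : Prop :=
  forall x, stablemx U (rho x).

Definition irreducible_subrepresentation (U : 'M[F]_n) : Prop :=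
  [/\ subrepresentation U, U != 0 &
      forall V : 'M[F]_n,
        subrepresentation V -> (V <= U)%MS -> V != 0 -> (U <= V)%MS].

Definition semisimple : Prop :=
  exists (I : finType) (U : I -> 'M[F]_n),
    [/\ forall i, irreducible_subrepresentation (U i),
        (\sum_i U i == 1%:M)%MS & mxdirect (\sum_i U i)%MS].

End Representations.

Lemma two_site_Omega_comm (F : numFieldType) m n (e f h x : 'M[F]_m)
    (S T : 'M[F]_m -> 'M[F]_n) :
  [/\ h = f *m e - e *m f, h *m e = - e, e *m h = e, h *m f = f & f *m h = - f] ->
  e *m e = 0 /\ f *m f = 0 ->
  (forall y z, S y *m S z = S (y *m z)) ->
  (forall y z, T y *m T z = T (y *m z)) ->
  (forall y z, S (y - z) = S y - S z) -> (forall y z, T (y - z) = T y - T z) ->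
  (forall y z, S y *m T z = T z *m S y) ->
  x \in [:: e; f; h] ->
  let Om := 2^-1 *: (S h *m T h)
            + S e *m T f + S f *m T e in
  (S x + T x) *m Om = Om *m (S x + T x).
Proof.
move=> [hE he eh hf fh] [ee ff] SM TM SB TB ST xE Om.
have S0 : S 0 = 0 by rewrite -(subrr (0 : 'M[F]_m)) SB subrr.
have T0 : T 0 = 0 by rewrite -(subrr (0 : 'M[F]_m)) TB subrr.
have SN y : S (- y) = - S y by rewrite -sub0r SB S0 sub0r.
have TN y : T (- y) = - T y by rewrite -sub0r TB T0 sub0r.
have S1 y z w : S y *m (S z *m T w) = S (y *m z) *m T w by rewrite mulmxA SM.
have T1 y z w : T y *m (S z *m T w) = S z *m T (y *m w).
  by rewrite mulmxA -ST -mulmxA TM.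
have S2 y z w : S z *m T w *m S y = S (z *m y) *m T w.
  by rewrite -mulmxA -ST mulmxA SM.
have T2 y z w : S z *m T w *m T y = S z *m T (w *m y) by rewrite -mulmxA TM.
have ShE : S h = S (f *m e) - S (e *m f) by rewrite -SB -hE.
have ThE : T h = T (f *m e) - T (e *m f) by rewrite -TB -hE.
rewrite /Om !(mulmxDl, mulmxDr) -!(scalemxAl, scalemxAr) !(S1, S2, T1, T2).
move: xE; rewrite !inE => /or3P[] /eqP ->;
  rewrite ?(he, eh, hf, fh, ee, ff) ?(SN, TN, S0, T0) ?(mulmxN, mulNmx)
    ?(mulmx0, mul0mx) ?ShE ?ThE ?(mulmxBl, mulmxBr);
  repeat (match goal with |- context [S ?y *m T ?z] =>
    move: (S y *m T z) => ? end); apply/matrixP => a b; rewrite !mxE; by field.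
Qed.

Lemma third_site_Omega_comm (F : numFieldType) m n (e f h : 'M[F]_m)
    (S T : 'M[F]_m -> 'M[F]_n) (Z : 'M[F]_n) :
  (forall y, Z *m S y = S y *m Z) -> (forall y, Z *m T y = T y *m Z) ->
  let Om := 2^-1 *: (S h *m T h)
            + S e *m T f + S f *m T e in
  Z *m Om = Om *m Z.
Proof.
move=> ZS ZT Om.
have ZST y w : Z *m (S y *m T w) = S y *m T w *m Z.
  by rewrite mulmxA ZS -(mulmxA (S y)) ZT mulmxA.
by rewrite /Om !mulmxDr !mulmxDl -scalemxAr -scalemxAl !ZST.
Qed.

Section Coinvariants.
Context (R : realType).
Local Notation C := (Cx R).

(* Vectors are rows, so a matrix stands for the operator of right
   multiplication: composition is reversed, and the raising operator, which
   sends the second basis vector to the first, is [delta_mx 1 0]. *)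
Definition sl2_e : 'M[C]_2 := delta_mx 1 0.
Definition sl2_f : 'M[C]_2 := delta_mx 0 1.
Definition sl2_h : 'M[C]_2 := delta_mx 0 0 - delta_mx 1 1.

Let sl2_relations : [/\ sl2_h = sl2_f *m sl2_e - sl2_e *m sl2_f,
  sl2_h *m sl2_e = - sl2_e, sl2_e *m sl2_h = sl2_e,
  sl2_h *m sl2_f = sl2_f & sl2_f *m sl2_h = - sl2_f].
Proof.
rewrite /sl2_h /sl2_e /sl2_f !mulmxBl !mulmxBr !mul_delta_mx.
by rewrite !mul_delta_mx_0 // !sub0r !subr0; split.
Qed.

Let sl2_squares : sl2_e *m sl2_e = 0 /\ sl2_f *m sl2_f = 0.
Proof. by rewrite !mul_delta_mx_0. Qed.

(* (C^2)^{(x)4} is 'rV_(2 * 2 * 2 * 2), with v1 (x) v2 (x) v3 (x) v4 the Kronecker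
   product v1 *t v2 *t v3 *t v4. *)
Definition tens4 (m : 'I_4 -> 'M[C]_2) : 'M[C]_(2 * 2 * 2 * 2) :=
  m 0 *t m 1 *t m 2 *t m 3.

Definition at_site (j : 'I_4) (x : 'M[C]_2) : 'M[C]_(2 * 2 * 2 * 2) :=
  tens4 (fun i => if i == j then x else 1%:M).

Definition diag_action (x : 'M[C]_2) : 'M[C]_(2 * 2 * 2 * 2) :=
  \sum_j at_site j x.

(* The row space is sl(2).(C^2)^{(x)4}, since e, f, h span sl(2). *)
Definition sl2_image : 'M[C]_(2 * 2 * 2 * 2) :=
  (diag_action sl2_e + diag_action sl2_f + diag_action sl2_h)%MS.

(* Only meaningful for j != k. *)
Definition Omega (j k : 'I_4) : 'M[C]_(2 * 2 * 2 * 2) :=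
  2^-1 *: (at_site j sl2_h *m at_site k sl2_h)
  + at_site j sl2_e *m at_site k sl2_f + at_site j sl2_f *m at_site k sl2_e.

(* The quotient of (C^2)^{(x)4} by the row space of [sl2_image] is realised as
   'rV_coinv_dim, with quotient map the right multiplication by [coinv_proj]:
   it is onto by [coinv_proj_surj], with kernel [sl2_image] by
   [coinv_proj_ker]. *)
Definition coinv_dim : nat := \rank (cokermx sl2_image).

Definition coinv_proj : 'M[C]_(2 * 2 * 2 * 2, coinv_dim) :=
  col_base (cokermx sl2_image).

Lemma coinv_proj_surj : row_full coinv_proj.
Proof. exact: col_base_full. Qed.

Lemma coinv_proj_ker m (v : 'M[C]_(m, 2 * 2 * 2 * 2)) :
  (v *m coinv_proj == 0) = (v <= sl2_image)%MS.
Proof.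
rewrite submxE -[in RHS](mulmx_base (cokermx sl2_image)) mulmxA.
apply/eqP/eqP => [->|]; first by rewrite mul0mx.
rewrite -[RHS](mul0mx _ (row_base (cokermx sl2_image))).
by apply: row_free_inj; exact: row_base_free.
Qed.

(* The operator induced on the quotient by an operator [X] that preserves
   [sl2_image]: lift along the quotient map, apply [X], project. It applies to
   the [Omega j k], by [Omega_stable]. *)
Definition coinv_op (X : 'M[C]_(2 * 2 * 2 * 2)) : 'M[C]_coinv_dim :=
  pinvmx coinv_proj *m X *m coinv_proj.

Lemma coinv_opE (X : 'M[C]_(2 * 2 * 2 * 2)) :
  stablemx sl2_image X -> coinv_proj *m coinv_op X = X *m coinv_proj.
Proof.
move=> sX; apply/eqP; rewrite -subr_eq0 /coinv_op.
set P := pinvmx _; have PK : P *m coinv_proj = 1%:M by rewrite mulVpmx ?coinv_proj_surj.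
have -> : coinv_proj *m (P *m X *m coinv_proj)
    = (coinv_proj *m P *m X) *m coinv_proj by rewrite !mulmxA.
rewrite -mulmxBl coinv_proj_ker -{2}[X]mul1mx -mulmxBl.
apply: submx_trans sX; apply: submxMr.
by rewrite -coinv_proj_ker mulmxBl -mulmxA PK mulmx1 mul1mx subrr.
Qed.

Let tens4M m m' : tens4 m *m tens4 m' = tens4 (fun i => m i *m m' i).
Proof. by rewrite /tens4 !tensmx_mul. Qed.

Let at_siteM j x y : at_site j x *m at_site j y = at_site j (x *m y).
Proof.
rewrite tens4M; congr tens4; apply/funext => i.
by case: eqP => // _; rewrite mulmx1.
Qed.

Let at_siteC i j x y : i != j ->
  at_site i x *m at_site j y = at_site j y *m at_site i x.
Proof.
move=> ij; rewrite !tens4M; congr tens4; apply/funext => k.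
have [->|ki] := eqVneq k i; last by rewrite mul1mx mulmx1.
by rewrite (negbTE ij) mul1mx mulmx1.
Qed.

Let at_siteB j x y : at_site j (x - y) = at_site j x - at_site j y.
Proof.
apply/matrixP => a b; case: j => [[|[|[|[|//]]]] lt4];
  rewrite /at_site /tens4 !mxE /=; ring.
Qed.

Let Omega_comm1 (j k : 'I_4) x (i : 'I_4) : i != j -> i != k ->
  at_site i x *m Omega j k = Omega j k *m at_site i x.
Proof.
move=> ij ik; apply: third_site_Omega_comm => y; exact: at_siteC.
Qed.

Let Omega_comm2 (j k : 'I_4) (x : 'M[C]_2) : j != k -> x \in [:: sl2_e; sl2_f; sl2_h] ->
  (at_site j x + at_site k x) *m Omega j k
  = Omega j k *m (at_site j x + at_site k x).
Proof.
move=> jk; apply: two_site_Omega_comm.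
- exact: sl2_relations.
- exact: sl2_squares.
- exact: at_siteM.
- exact: at_siteM.
- exact: at_siteB.
- exact: at_siteB.
- by move=> y z; exact: at_siteC.
Qed.

Lemma Omega_stable (j k : 'I_4) : j != k -> stablemx sl2_image (Omega j k).
Proof.
move=> jk.
have comm x : x \in [:: sl2_e; sl2_f; sl2_h] ->
    stablemx (diag_action x) (Omega j k).
  move=> xE; suff -> :
    diag_action x *m Omega j k = Omega j k *m diag_action x by exact: submxMl.
  have -> : diag_action x = at_site j x + at_site k x
      + \sum_(i | (i != j) && (i != k)) at_site i x.
    by rewrite /diag_action (bigD1 j) //= (bigD1 k) 1?eq_sym //= addrA.
  set X := \sum_(i | _) _.
  have XO : X *m Omega j k = Omega j k *m X.
    have O1 := @Omega_comm1 j k x; move: (Omega j k) O1 => W O1.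
    rewrite /X mulmx_suml mulmx_sumr.
    by apply: eq_bigr => i /andP[]; exact: O1.
  have O2 := Omega_comm2 jk xE.
  move: (at_site j x + at_site k x) O2 => Y O2.
  by rewrite (mulmxDl Y X) (mulmxDr (Omega j k) Y X) XO O2.
by rewrite /sl2_image !stableDmx ?comm // !inE eqxx ?orbT.
Qed.

End Coinvariants.

Section KZ.
Context {R : realType}.
Local Notation C := (Cx R).

Definition conf4 : set 'rV[C]_4 :=
  [set z | forall j k : 'I_4, j != k -> z 0 j != z 0 k].

(* [u] is a holomorphic flat section over the open set [U]; only the values of
   [u] on [U] matter. *)
Definition KZ_flat_on (kappa : C) (U : set 'rV[C]_4)
    (u : 'rV[C]_4 -> 'rV[C]_(coinv_dim R)) : Prop :=
  [/\ open U, U `<=` conf4 &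
      forall z, U z ->
        differentiable u z /\
        forall j : 'I_4,
          'D_(delta_mx 0 j) u z
          + kappa^-1 *: (\sum_(k < 4 | k != j)
              (z 0 j - z 0 k)^-1 *: (u z *m coinv_op (Omega R j k))) = 0].

(* [w] is the continuation of [v] along [a]: there is a family of vectors
   [s t] in the fibres over [a t], joining [v] to [w], which is locally the
   restriction to [a] of a flat section. *)
Definition KZ_continuation (kappa : C) (a : R -> 'rV[C]_4)
    (v w : 'rV[C]_(coinv_dim R)) : Prop :=
  exists s : R -> 'rV[C]_(coinv_dim R),
    [/\ s 0 = v, s 1 = w &
        forall t : R, t \in `[0, 1] ->
          exists U u, [/\ KZ_flat_on kappa U u, U (a t) &
            \forall t' \near t, t' \in `[0, 1] -> s t' = u (a t')]].

(* These conditions determine [rho]: the continuation of [v] along [a] is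
   unique, by uniqueness of local flat sections with a given value. *)
Definition is_KZ_monodromy (kappa : C) (z0 : 'rV[C]_4) (z0_conf : conf4 z0)
    (rho : pi1 (R := R) z0_conf -> 'M[C]_(coinv_dim R)) : Prop :=
  is_representation rho /\
  forall (a : loop conf4 z0) (v : 'rV[C]_(coinv_dim R)),
    KZ_continuation kappa a v (v *m rho (pi1_class z0_conf a)).

End KZ.

(* Main.v *)
Require Import Defs.
From mathcomp Require Import all_boot all_order all_algebra.
From mathcomp Require Import all_classical all_reals all_analysis.
From mathcomp Require Import complex.
From mathcomp Require Import mxtens ring lra.

(* The functionals [eps12 eps34] and [eps13 eps24] identify the coinvariants with
   C^2, where [Omega_jk] becomes a transposition minus 1/2. With z_jk = z_j - z_k
   and D the product of the z_jk (j < k), the vector D^(-1/6) (z12 z34, z13 z24) is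
   flat when kappa = 3 (it is dual to the level one conformal block), so its line is
   invariant under the monodromy.
   On the affine line t |-> (4b, 0, 6b - 2t, 3b - t), a second solution has
   coordinate f relative to the first, with f' a branch of a multiple of
   (t^2 - b^2)^(-1/3). A figure eight around t = b and t = -b brings the branch
   of f' back to itself, but adds a nonzero period to f: on a suitable quadrilateral
   (b = 123, vertices 145 -+ 26i and -145 -+ 26i) the real part of f' dt stays
   positive. The loop thus acts as a scalar plus a nonzero nilpotent map whose image
   lies in the invariant line, and such a map would vanish on every irreducible
   summand of a semisimple representation. *)

Set Implicit Arguments.
Unset Strict Implicit.
Unset Printing Implicit Defensive.

Import Order.TTheory GRing.Theory Num.Theory.

Local Open Scope ring_scope.

(** * Invariant functionals *)

Section InvariantFunctionals.
Context (R : realType).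
Local Notation C := (Cx R).

(** Fractional powers are the obstacle: along a continuation they would call for a choice of branch.
    They are replaced by single valued first integrals. The component transverse to the invariant
    line, the determinant of two solutions and the first coordinate of a solution in the line vary
    like D^(1/2), D^(1/3) and z12 z34 D^(-1/6); their powers 2, 3 and 6, corrected by D and z12 z34,
    are locally constant along a path, hence constant. The same integrals do the work of a
    uniqueness theorem for flat sections. So only the cube of f' is known, and its branch is tracked
    by a sign: for a suitable complex number m, the real part of m f' does not vanish on an edge of
    the quadrilateral, keeps its sign there, and at the next vertex this sign selects one of three
    cube roots. The vertices are chosen so that, up to a common scalar, these roots are Gaussian
    integers; the checks then become inequalities between rationals. *)

Definition tens_col (g : 'I_2 -> 'I_2 -> 'I_2 -> 'I_2 -> C) : 'cV[C]_(2 * 2 * 2 * 2) :=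
  \col_i (let: (i', i3) := mxtens_unindex i in
          let: (i'', i2) := mxtens_unindex i' in
          let: (i0, i1) := mxtens_unindex i'' in g i0 i1 i2 i3).

Lemma modn12 : (1 %% 2)%N = 1%N. Proof. by []. Qed.

Lemma sum_mxtens m n (F : 'I_(m * n) -> C) :
  \sum_k F k = \sum_i \sum_j F (mxtens_index (i, j)).
Proof.
rewrite pair_big /= (reindex (@mxtens_index m n)) /=; last first.
  by exists (@mxtens_unindex m n) => i _; rewrite (mxtens_indexK, mxtens_unindexK).
by apply: eq_bigr => -[].
Qed.

(** Columns are the functionals on row tensors, so operators act on them from the left. *)
Lemma tens4_col m g : tens4 m *m tens_col g =
  tens_col (fun i0 i1 i2 i3 => \sum_k0 \sum_k1 \sum_k2 \sum_k3
    m 0 i0 k0 * m 1 i1 k1 * m 2 i2 k2 * m 3 i3 k3 * g k0 k1 k2 k3).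
Proof.
apply/colP => i; rewrite !mxE.
rewrite -(mxtens_unindexK i); case: (mxtens_unindex i) => i' i3; rewrite mxtens_indexK.
rewrite -(mxtens_unindexK i'); case: (mxtens_unindex i') => i'' i2; rewrite mxtens_indexK.
rewrite -(mxtens_unindexK i''); case: (mxtens_unindex i'') => i0 i1; rewrite mxtens_indexK !sum_mxtens.
apply: eq_bigr => k0 _; apply: eq_bigr => k1 _; apply: eq_bigr => k2 _.
apply: eq_bigr => k3 _.
by rewrite /tens4 !tensmxE !mxE !mxtens_indexK.
Qed.

Lemma sum_1mx n (i : 'I_n) (F : 'I_n -> C) :
  \sum_k (1%:M : 'M[C]_n) i k * F k = F i.
Proof.
rewrite (bigD1 i) //= mxE eqxx mul1r big1 ?addr0 // => k ki.
by rewrite mxE eq_sym (negbTE ki) mul0r.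
Qed.

Lemma tens_col_ext g g' : (forall i0 i1 i2 i3, g i0 i1 i2 i3 = g' i0 i1 i2 i3) ->
  tens_col g = tens_col g'.
Proof. by move=> gg; apply/colP => i; rewrite !mxE; do 3!case: mxtens_unindex => ? ?. Qed.

Lemma at_site_col j x g : at_site j x *m tens_col g =
  tens_col (fun i0 i1 i2 i3 =>
   match val j with
   | 0%N => \sum_k x i0 k * g k i1 i2 i3
   | 1%N => \sum_k x i1 k * g i0 k i2 i3
   | 2%N => \sum_k x i2 k * g i0 i1 k i3
   | _ => \sum_k x i3 k * g i0 i1 i2 k
   end).
Proof.
rewrite /at_site tens4_col; apply: tens_col_ext => i0 i1 i2 i3.
set y := fun i : 'I_4 => if i == j then x else 1%:M.
have -> : \sum_k0 \sum_k1 \sum_k2 \sum_k3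
    y 0 i0 k0 * y 1 i1 k1 * y 2 i2 k2 * y 3 i3 k3 * g k0 k1 k2 k3 =
  \sum_k0 y 0 i0 k0 * \sum_k1 y 1 i1 k1 * \sum_k2 y 2 i2 k2 * \sum_k3
    y 3 i3 k3 * g k0 k1 k2 k3.
  apply: eq_bigr => k0 _; rewrite !mulr_sumr; apply: eq_bigr => k1 _.
  rewrite !mulr_sumr; apply: eq_bigr => k2 _; rewrite !mulr_sumr.
  by apply: eq_bigr => k3 _; rewrite !mulrA.
rewrite /y; case: j {y} => -[|[|[|[|//]]]] jl /=; rewrite ?sum_1mx.
- by apply: eq_bigr => k _; rewrite !sum_1mx.
- by apply: eq_bigr => k _; rewrite !sum_1mx.
- by apply: eq_bigr => k _; rewrite !sum_1mx.
- by [].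
Qed.

Lemma tens_colD g g' : tens_col g + tens_col g' =
  tens_col (fun i0 i1 i2 i3 => g i0 i1 i2 i3 + g' i0 i1 i2 i3).
Proof. by apply/colP => i; rewrite !mxE; do 3!case: mxtens_unindex => ? ?. Qed.

Lemma tens_colZ k g : k *: tens_col g =
  tens_col (fun i0 i1 i2 i3 => k * g i0 i1 i2 i3).
Proof. by apply/colP => i; rewrite !mxE; do 3!case: mxtens_unindex => ? ?. Qed.

Lemma tens_col0 : tens_col (fun _ _ _ _ => 0) = 0.
Proof. by apply/colP => i; rewrite !mxE; do 3!case: mxtens_unindex => ? ?. Qed.

(** The invariant symplectic form of the plane. Written as a difference of indices, it makes the
    Plücker relation between [psi1], [psi2] and the third product of this kind a polynomial
    identity. *)
Definition eps (i j : 'I_2) : C := (val j)%:R - (val i)%:R.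
Definition psi1 := tens_col (fun i0 i1 i2 i3 => eps i0 i1 * eps i2 i3).
Definition psi2 := tens_col (fun i0 i1 i2 i3 => eps i0 i2 * eps i1 i3).

Local Opaque tens_col at_site.

Lemma sum_sl2_e (i : 'I_2) (F : 'I_2 -> C) :
  \sum_k sl2_e R i k * F k = (val i)%:R * F 0.
Proof.
rewrite !big_ord_recl !big_ord0 /sl2_e !mxE /=.
by case: i => -[|[|//]] ? /=; rewrite ?mul0r ?mul1r ?addr0.
Qed.

Lemma sum_sl2_f (i : 'I_2) (F : 'I_2 -> C) :
  \sum_k sl2_f R i k * F k = (1 - (val i)%:R) * F 1.
Proof.
have -> : 1 = lift ord0 ord0 :> 'I_2 by apply: val_inj.
rewrite !big_ord_recl !big_ord0 /sl2_f !mxE /=.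
by case: i => -[|[|//]] ? /=; rewrite ?subr0 ?subrr ?mul0r ?mul1r ?addr0 ?add0r.
Qed.

Lemma sum_sl2_h (i : 'I_2) (F : 'I_2 -> C) :
  \sum_k sl2_h R i k * F k = (1 - 2 * (val i)%:R) * F i.
Proof.
rewrite !big_ord_recl !big_ord0 /sl2_h !mxE /=.
have [->|->] : i = 0 \/ i = lift ord0 ord0.
  by case: i => -[|[|//]] ? ; [left|right]; apply: val_inj.
- by rewrite /= mulr0n; ring.
- by rewrite /= (_ : bump 0 0 = 1%N) //; ring.
Qed.
Local Opaque sl2_e sl2_f sl2_h.

Lemma ord2_natr (i : 'I_2) : (val i)%:R = 0 :> C \/ (val i)%:R = 1 :> C.
Proof. by case: i => -[|[|//]] ? /=; [left|right]. Qed.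

Lemma diag_col x g : diag_action x *m tens_col g =
  tens_col (fun i0 i1 i2 i3 =>
    \sum_k x i0 k * g k i1 i2 i3 + \sum_k x i1 k * g i0 k i2 i3 +
    \sum_k x i2 k * g i0 i1 k i3 + \sum_k x i3 k * g i0 i1 i2 k).
Proof.
rewrite /diag_action mulmx_suml.
under eq_bigr do rewrite at_site_col.
rewrite !big_ord_recl big_ord0 addr0.
rewrite !tens_colD; apply: tens_col_ext => i0 i1 i2 i3 /=.
by rewrite !addrA.
Qed.

Lemma diag_psi x : x \in [:: sl2_e R; sl2_f R; sl2_h R] ->
  diag_action x *m psi1 = 0 /\ diag_action x *m psi2 = 0.
Proof.
move=> xE; rewrite /psi1 /psi2 -tens_col0; split; rewrite diag_col; apply: tens_col_ext => i0 i1 i2 i3.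
all: move: xE; rewrite !inE => /or3P[] /eqP ->.
all: rewrite ?sum_sl2_e.
all: rewrite ?sum_sl2_f.
all: rewrite ?sum_sl2_h.
all: rewrite /eps /= ?modn12.
all: try ring.
all: case: (ord2_natr i0) => ->; case: (ord2_natr i1) => ->;
  case: (ord2_natr i2) => ->; case: (ord2_natr i3) => ->; ring.
Qed.

Definition swap_sites (j k : nat) (g : 'I_2 -> 'I_2 -> 'I_2 -> 'I_2 -> C) i0 i1 i2 i3 :=
  let i := fun l => nth i0 [:: i0; i1; i2; i3]
    (if l == j then k else if l == k then j else l) in
  g (i 0%N) (i 1%N) (i 2%N) (i 3%N).

(** The Casimir tensor of sl(2) is the exchange of the two factors minus half the identity. *)
Lemma Omega_pair (i j : 'I_2) (G : 'I_2 -> 'I_2 -> C) :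
  2^-1 * (\sum_k sl2_h R i k * \sum_l sl2_h R j l * G k l)
  + \sum_k sl2_e R i k * (\sum_l sl2_f R j l * G k l)
  + \sum_k sl2_f R i k * (\sum_l sl2_e R j l * G k l) = G j i - 2^-1 * G i j.
Proof.
rewrite !(sum_sl2_e, sum_sl2_f, sum_sl2_h).
have ord2P (k : 'I_2) : k = 0 \/ k = 1.
  by case: k => -[|[|//]] ?; [left|right]; exact: val_inj.
case: (ord2P i) => ->; case: (ord2P j) => -> /=.
all: rewrite ?modn12 ?mulr0n; by field.
Qed.

Lemma Omega_col (j k : 'I_4) g : j != k -> Omega R j k *m tens_col g =
  tens_col (fun i0 i1 i2 i3 => swap_sites j k g i0 i1 i2 i3 - 2^-1 * g i0 i1 i2 i3).
Proof.
move=> jk.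
have G (X X' Y Y' Z Z' : 'M[C]_(2 * 2 * 2 * 2)) (v : 'cV_(2 * 2 * 2 * 2)) :
    (2^-1 *: (X *m X') + Y *m Y' + Z *m Z') *m v =
    2^-1 *: (X *m (X' *m v)) + Y *m (Y' *m v) + Z *m (Z' *m v).
  by rewrite !mulmxDl -scalemxAl -!mulmxA.
rewrite /Omega G.
rewrite 3!(at_site_col k).
rewrite 3!(at_site_col j).
rewrite tens_colZ 2!tens_colD; apply: tens_col_ext => i0 i1 i2 i3.
case: j jk => -[|[|[|[|//]]]] jl; case: k => -[|[|[|[|//]]]] kl //= _.
- exact: (Omega_pair i0 i1 (fun a b => g a b i2 i3)).
- exact: (Omega_pair i0 i2 (fun a b => g a i1 b i3)).
- exact: (Omega_pair i0 i3 (fun a b => g a i1 i2 b)).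
- exact: (Omega_pair i1 i0 (fun a b => g b a i2 i3)).
- exact: (Omega_pair i1 i2 (fun a b => g i0 a b i3)).
- exact: (Omega_pair i1 i3 (fun a b => g i0 a i2 b)).
- exact: (Omega_pair i2 i0 (fun a b => g b i1 a i3)).
- exact: (Omega_pair i2 i1 (fun a b => g i0 b a i3)).
- exact: (Omega_pair i2 i3 (fun a b => g i0 i1 a b)).
- exact: (Omega_pair i3 i0 (fun a b => g b i1 i2 a)).
- exact: (Omega_pair i3 i1 (fun a b => g i0 b i2 a)).
- exact: (Omega_pair i3 i2 (fun a b => g i0 i1 b a)).
Qed.

(* The three ways of splitting the four sites into two pairs. *)
Definition pairing (j k : nat) : nat :=
  match j, k with
  | 0, 1 | 1, 0 | 2, 3 | 3, 2 => 0
  | 0, 2 | 2, 0 | 1, 3 | 3, 1 => 1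
  | _, _ => 2
  end%N.

(** A transposition minus 1/2 in terms of [psi1] and [psi2], by the Plücker relation
    [eps02 eps13 = eps01 eps23 + eps03 eps12]. A product of two disjoint transpositions acts
    trivially, so complementary pairs share their coefficients. *)
Definition Omega_coef (p : nat) : (C * C) * (C * C) :=
  match p with
  | 0%N => ((- (3 / 2), 0), (-1, 2^-1))
  | 1%N => ((2^-1, -1), (0, - (3 / 2)))
  | _ => ((- 2^-1, 1), (1, - 2^-1))
  end.

Lemma Omega_psi (j k : 'I_4) : j != k -> let c := Omega_coef (pairing j k) in
  Omega R j k *m psi1 = c.1.1 *: psi1 + c.1.2 *: psi2 /\
  Omega R j k *m psi2 = c.2.1 *: psi1 + c.2.2 *: psi2.
Proof.
move=> jk c; rewrite /psi1 /psi2 !Omega_col // !tens_colZ !tens_colD {}/c.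
split; apply: tens_col_ext => i0 i1 i2 i3.
all: case: j jk => -[|[|[|[|//]]]] jl; case: k => -[|[|[|[|//]]]] kl //= _.
all: rewrite /swap_sites /eps /=; by field.
Qed.

Local Transparent tens_col.
Definition Psi : 'M[C]_(2 * 2 * 2 * 2, 2) := \matrix_(i, j) (if j == 0 then psi1 i 0 else psi2 i 0).
(** The descent of [Psi] to the quotient. [pinvmx] picks a lift of each class; as [Psi] kills
    [sl2_image], the choice does not matter, which is what [coinv_proj_Phi] records. *)
Definition Phi : 'M[C]_(coinv_dim R, 2) := pinvmx (coinv_proj R) *m Psi.

Lemma mul_Psi m (A : 'M[C]_(m, 2 * 2 * 2 * 2)) i j :
  (A *m Psi) i j = if j == 0 then (A *m psi1) i 0 else (A *m psi2) i 0.
Proof. by rewrite !mxE; case: ifP => j0; apply: eq_bigr => k _; rewrite mxE j0. Qed.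

Lemma sl2_image_Psi : sl2_image R *m Psi = 0.
Proof.
have h x : x \in [:: sl2_e R; sl2_f R; sl2_h R] -> (diag_action x <= kermx Psi)%MS.
  move=> /diag_psi[h1 h2]; apply/sub_kermxP/matrixP => i j.
  by rewrite mul_Psi h1 h2 !mxE if_same.
apply/sub_kermxP; rewrite /sl2_image !addsmx_sub !h //.
all: by rewrite !inE eqxx ?orbT.
Qed.

Lemma coinv_proj_Phi : coinv_proj R *m Phi = Psi.
Proof.
apply/eqP; rewrite -subr_eq0 /Phi mulmxA -{2}[Psi]mul1mx -mulmxBl.
apply/eqP/sub_kermxP; apply: (submx_trans (B := sl2_image R)).
  rewrite -coinv_proj_ker mulmxBl -mulmxA.
  by rewrite mulVpmx ?coinv_proj_surj // mulmx1 mul1mx subrr.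
exact/sub_kermxP/sl2_image_Psi.
Qed.

Lemma sum_delta_col (v0 v1 v2 v3 : 'I_2) g :
  \sum_j (j == mxtens_index (mxtens_index (mxtens_index (v0, v1), v2), v3))%:R
    * tens_col g j 0 = g v0 v1 v2 v3.
Proof.
set v := mxtens_index _.
rewrite (bigD1 v) //= eqxx mul1r big1 ?addr0 => [|k /negbTE->].
  by rewrite mxE !mxtens_indexK.
by rewrite mul0r.
Qed.

Lemma Phi_surj (x y : C) : exists u : 'rV[C]_(coinv_dim R),
  (u *m Phi) 0 0 = x /\ (u *m Phi) 0 1 = y.
Proof.
pose v (i0 i1 i2 i3 : 'I_2) := mxtens_index (mxtens_index (mxtens_index (i0, i1), i2), i3).
(* On the basis tensors 0110 and 0011 the pair ([psi1], [psi2]) takes the values (-1, -1) and (0,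
   1). *)
pose Y : 'rV[C]_(2 * 2 * 2 * 2) :=
  \row_j (- x * (j == v 0 1 1 0)%:R + (y - x) * (j == v 0 0 1 1)%:R).
have YE g : (Y *m tens_col g) 0 0 = - x * g 0 1 1 0 + (y - x) * g 0 0 1 1.
  rewrite mxE -!(sum_delta_col _ _ _ _ g) !mulr_sumr -big_split /=.
  by apply: eq_bigr => j _; rewrite [Y _ _]mxE mulrDl !mulrA.
exists (Y *m coinv_proj R).
rewrite -mulmxA coinv_proj_Phi !mul_Psi !YE /eps /= !modn12.
split; ring.
Qed.

Lemma coinv_op_Phi (j k : 'I_4) (u : 'rV[C]_(coinv_dim R)) : j != k ->
  let c := Omega_coef (pairing j k) in
  (u *m coinv_op (Omega R j k) *m Phi) 0 0 =
    c.1.1 * (u *m Phi) 0 0 + c.1.2 * (u *m Phi) 0 1 /\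
  (u *m coinv_op (Omega R j k) *m Phi) 0 1 =
    c.2.1 * (u *m Phi) 0 0 + c.2.2 * (u *m Phi) 0 1.
Proof.
move=> jk c; pose w := u *m pinvmx (coinv_proj R).
have G p q r (P : 'M[C]_(p, q)) (X : 'M[C]_q) (Q : 'M[C]_(q, p)) (F : 'M[C]_(p, r))
    (v : 'rV[C]_p) : v *m (P *m X *m Q) *m F = v *m P *m X *m (Q *m F).
  by rewrite !mulmxA.
have E1 : u *m coinv_op (Omega R j k) *m Phi = w *m Omega R j k *m Psi.
  by rewrite /coinv_op G coinv_proj_Phi.
have E2 : u *m Phi = w *m Psi by rewrite /Phi /w mulmxA.
rewrite E1 E2.
have [h1 h2] := Omega_psi jk; move: h1 h2; rewrite -/c => h1 h2.
have L n (v : 'rV[C]_n) (p q : 'cV[C]_n) a b :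
    (v *m (a *: p + b *: q)) 0 0 = a * (v *m p) 0 0 + b * (v *m q) 0 0.
  by rewrite mulmxDr -!scalemxAr !mxE.
have P0 (v : 'rV[C]_(2 * 2 * 2 * 2)) : (v *m Psi) 0 0 = (v *m psi1) 0 0 by exact: mul_Psi.
have P1 (v : 'rV[C]_(2 * 2 * 2 * 2)) : (v *m Psi) 0 1 = (v *m psi2) 0 0 by exact: mul_Psi.
rewrite 2!P0 2!P1.
by split; rewrite -L -?h1 -?h2 mulmxA.
Qed.

End InvariantFunctionals.

Import numFieldNormedType.Exports.

Local Open Scope classical_set_scope.
Local Open Scope ring_scope.

(** * Complex derivatives along real segments *)

Section ComplexDerivatives.
Context (R : realType).
Local Notation C := (Cx R).

Definition rc (x : R) : C := Complex x 0.
Definition re (z : C) : R := complex.Re z.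
Definition im (z : C) : R := complex.Im z.

Definition ic : C := Complex 0 1.

Lemma rcD x y : rc (x + y) = rc x + rc y. Proof. exact: (rmorphD (real_complex R)). Qed.
Lemma rcB x y : rc (x - y) = rc x - rc y. Proof. exact: (rmorphB (real_complex R)). Qed.
Lemma rcV x : rc x^-1 = (rc x)^-1. Proof. exact: (fmorphV (real_complex R)). Qed.
Lemma reB z w : re (z - w) = re z - re w. Proof. by case: z w => [? ?] [? ?]. Qed.
Lemma reM z w : re (z * w) = re z * re w - im z * im w. Proof. by case: z w => [? ?] [? ?]. Qed.

Lemma norm_rc x : `|rc x| = rc `|x|.
Proof. by rewrite normc_def /= expr0n addr0 sqrtr_sqr. Qed.

Lemma lt_rc x y : (rc x < rc y) = (x < y). Proof. exact: ltcR. Qed.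

Lemma ltC_rc (e : C) : 0 < e -> exists2 d : R, 0 < d & e = rc d.
Proof.
case: e => a b; rewrite ltcE /= => /andP[/eqP-> a0]; by exists a.
Qed.

Lemma re_le z : rc `|re z| <= `|z|.
Proof.
by rewrite normc_def lecR -sqrtr_sqr; apply: ler_wsqrtr; rewrite lerDl sqr_ge0.
Qed.

Lemma continuous_rc : continuous rc.
Proof.
move=> x; apply/cvgrPdist_lt => e /ltC_rc[d d0 ->].
near=> y; rewrite -rcB norm_rc lt_rc.
near: y; exact: cvgr_dist_lt.
Unshelve. all: by end_near. Qed.

Lemma continuous_re : continuous (re : C -> R).
Proof.
move=> z; apply/(@cvgrPdist_lt _ _ _ (nbhs z) (nbhs_filter z)) => e e0.
apply/nbhs_ballP; exists (rc e) => /=.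
  by rewrite (_ : 0 = rc 0) // lt_rc.
move=> w; rewrite -ball_normE /= => zw; rewrite -reB -lt_rc.
exact: le_lt_trans (re_le _) zw.
Qed.

(** Restriction of a complex derivative to the real axis: it brings the real mean value and
    intermediate value theorems to bear on complex functions. *)
Lemma is_derive_re (h : C -> C) (t : R) (c : C) :
  is_derive (rc t) (1 : C) h c -> is_derive t (1 : R) (fun s => re (h (rc s))) (re c).
Proof.
move=> [/cvg_ex[l hl] hc].
have {hc l hl} hc : (fun k : C => k^-1 *: ((h \o shift (rc t)) (k *: (1 : C)) - h (rc t)))
  @ 0^' --> c.
  by rewrite -hc /derive; apply/cvg_ex; exists l.
have E : (fun k : R => k^-1 *: (((fun s => re (h (rc s))) \o shift t) (k *: (1 : R)) - re (h (rc t))))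
  @ 0^' --> re c.
  have H : rc @ (0 : R)^' --> (0 : C)^'.
    move=> A /= [e /ltC_rc[d d0 ->] hA]; exists d => //= k /= kd k0; apply: hA => /=.
      by rewrite sub0r normrN norm_rc lt_rc; rewrite sub0r normrN in kd.
    by apply/eqP => -[]; exact/eqP.
  have := cvg_comp _ _ (cvg_comp _ _ H hc) (@continuous_re c).
  apply: cvg_trans; apply: near_eq_cvg; near=> k.
  have reZ x z : re (rc x * z) = x * re z by rewrite reM mul0r subr0.
  rewrite /= ![_%:A]mulr1 -rcD -rcV -reB; exact: reZ.
split; first by apply/cvg_ex; exists (re c).
exact: cvg_lim E.
Unshelve. all: by end_near. Qed.

Lemma derive0_eq_real (h : R -> R) :
  (forall t : R, t \in `[0, 1] -> is_derive t (1 : R) h 0) -> h 1 = h 0.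
Proof.
move=> h0.
have h1 (x : R) : x \in `]0, 1[%R -> is_derive x (1 : R) h 0.
  by rewrite in_itv /= => /andP[? ?]; apply: h0; rewrite in_itv /= !ltW.
have h2 : {within `[0, 1], continuous h}.
  by apply: derivable_within_continuous => t /h0[].
have [c _] := MVT ltr01 h1 h2.
by rewrite mul0r => /eqP; rewrite subr_eq0 => /eqP.
Qed.

Lemma derive0_eq (h : C -> C) :
  (forall t : R, t \in `[0, 1] -> is_derive (rc t) (1 : C) h 0) -> h 1 = h 0.
Proof.
move=> h0.
have e1 : re (h 1) = re (h 0).
  by apply: (@derive0_eq_real (fun t => re (h (rc t)))) => t /h0/is_derive_re.
(* The real part of [ic * h] is minus the imaginary part of [h]. *)
have e2 : re (ic * h 1) = re (ic * h 0).
  apply: (@derive0_eq_real (fun t => re (ic * h (rc t)))) => t /h0 dh.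
  have : is_derive (rc t) (1 : C) (fun z => ic *: h z) 0.
    by rewrite -(scaler0 _ ic); exact: is_deriveZ.
  exact: is_derive_re.
move: e1 e2; case: (h 1) (h 0) => [a b] [a' b']; rewrite /re /= => -> /eqP.
by rewrite !mul0r !mul1r !sub0r eqr_opp => /eqP ->.
Qed.

(** Connectedness of the interval: the function [f] that is 0 where [Q] keeps its initial value and
    1 elsewhere is continuous, so it cannot skip the value 1/2. *)
Lemma locally_constant (T : Type) (Q : R -> T) :
  (forall t : R, t \in `[0, 1] -> \forall t' \near t, t' \in `[0, 1] -> Q t' = Q t) ->
  forall t : R, t \in `[0, 1] -> Q t = Q 0.
Proof.
move=> lc t t01; have t0 : 0 <= t by move: t01; rewrite in_itv /= => /andP[].
have t1 : t <= 1 by move: t01; rewrite in_itv /= => /andP[].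
pose f (s : R) : R := if `[< Q s = Q 0 >] then 0 else 1.
have cf : {within `[0, t], continuous f}.
  apply/subspace_continuousP => s; rewrite /= in_itv /= => /andP[s0 st].
  have s01 : s \in `[0, 1] by rewrite in_itv /= s0 (le_trans st).
  apply: cvg_near_cst; have := lc s s01; apply: filterS => r h rI /=.
  have r01 : r \in `[0, 1].
    by move: rI; rewrite /= !in_itv /= => /andP[-> /le_trans->].
  by rewrite /from_subspace /f (h r01).
have [Qt|Qt] := pselect (Q t = Q 0) => //.
have [|c _] := IVT (v := 2^-1) t0 cf.
  rewrite /f; case: asboolP => // _; case: asboolP => // _.
  rewrite min_l ?max_r //; apply/andP; split; lra.
by rewrite /f; case: ifP => _ h; exfalso; lra.
Qed.

Lemma is_derive_translate (g : C -> C) (c0 l : C) :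
  is_derive (0 : C) (1 : C) (fun c => g (c0 + c)) l -> is_derive c0 (1 : C) g l.
Proof.
have E : (fun h : C => h^-1 *: (((fun c => g (c0 + c)) \o shift 0) (h *: (1 : C)) - g (c0 + 0)))
    = (fun h : C => h^-1 *: ((g \o shift c0) (h *: (1 : C)) - g c0)).
  by apply/funext => h; rewrite /= !addr0 (addrC c0).
move=> [d <-]; split; first by rewrite /derivable -E.
by rewrite /derive -E.
Qed.

Lemma is_derive_line n m (f : 'rV[C]_n -> 'rV[C]_m) (z w : 'rV[C]_n) l :
  is_derive z w f l ->
  (fun h : C => h^-1 *: (f (z + h *: w) - f z)) @ 0^' --> l.
Proof.
have E : (fun h : C => h^-1 *: (f (z + h *: w) - f z))
    = (fun h : C => h^-1 *: ((f \o shift z) (h *: w) - f z)).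
  by apply/funext => h; rewrite /= (addrC z).
by move=> [/cvg_ex[l' hl] <-]; rewrite E /derive; apply/cvg_ex; exists l'.
Qed.

Lemma is_derive_line_translate n (F : 'rV[C]_n -> C) (z w : 'rV[C]_n) (c0 l : C) :
  is_derive (0 : C) (1 : C) (fun c => F (z + c0 *: w + c *: w)) l ->
  is_derive c0 (1 : C) (fun c => F (z + c *: w)) l.
Proof.
pose g (c : C) : C := F (z + c *: w).
have -> : (fun c : C => F (z + c0 *: w + c *: w)) = (fun c => g (c0 + c)).
  by apply/funext => c; rewrite /g scalerDl addrA.
exact: is_derive_translate.
Qed.

(** A ball contains the segment from its centre to each of its points, and the derivative vanishes
    along that segment. *)
Lemma line_constant n (U : set 'rV[C]_n) (H : 'rV[C]_n -> C) : open U ->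
  (forall z w, U z -> is_derive (0 : C) (1 : C) (fun c => H (z + c *: w)) 0) ->
  forall z, U z -> \forall z' \near z, H z' = H z.
Proof.
move=> oU dH z Uz.
have /nbhs_ballP[e /= e0 eU] : nbhs z U by exact: open_nbhs_nbhs.
have := nbhsx_ballx z e e0; apply: filterS => z' zz'.
pose w := z' - z.
have -> : z' = z + 1 *: w by rewrite scale1r addrC subrK.
have -> : H z = H (z + 0 *: w) by rewrite scale0r addr0.
apply: (@derive0_eq (fun c => H (z + c *: w))) => t t01.
have Ut : U (z + rc t *: w).
  apply: eU; move: zz'; rewrite -!ball_normE /=.
  rewrite opprD addrA subrr sub0r normrN normrZ norm_rc.
  rewrite -normrN opprB -/w; apply: le_lt_trans.
  rewrite -[leRHS]mul1r ler_wpM2r // (_ : 1 = rc 1) // lecR.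
  by move: t01; rewrite in_itv /= => /andP[t0 t1]; rewrite ger0_norm.
exact: is_derive_line_translate (dH _ w Ut).
Qed.

Lemma is_derive_entry n m (f : 'rV[C]_n -> 'rV[C]_m) (z w : 'rV[C]_n) l
    p (A : 'M[C]_(m, p)) j :
  is_derive z w f l ->
  is_derive (0 : C) (1 : C) (fun c => (f (z + c *: w) *m A) 0 j) ((l *m A) 0 j).
Proof.
move=> /is_derive_line dl.
have cA : continuous (fun v : 'rV[C]_m => (v *m A) 0 j).
  rewrite (_ : (fun v => _) = (fun v : 'rV[C]_m => \sum_i v 0 i * A i j)); last first.
    by apply/funext => ?; rewrite mxE.
  apply: (@continuous_big _ _ +%R 0) => [|i _ v]; first exact: add_continuous.
  have c1 : (fun w : 'rV[C]_m => w 0 i) @ v --> v 0 i := @coord_continuous C 1 m 0 i v.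
  exact: (continuous_comp c1 (@mulrr_continuous C (A i j) (v 0 i))).
have := cvg_comp _ _ dl (cA l).
have -> : ((fun v : 'rV[C]_m => (v *m A) 0 j) \o (fun h : C => h^-1 *: (f (z + h *: w) - f z)))
   = (fun h : C => h^-1 *: (((fun c : C => (f (z + c *: w) *m A) 0 j) \o shift 0) (h *: (1 : C)) -
       (f (z + (0 : C) *: w) *m A) 0 j)).
  apply/funext => h /=; rewrite addr0 [_%:A]mulr1 scale0r addr0.
  by rewrite -scalemxAl mulmxBl !mxE.
move=> h; split; first by apply/cvg_ex; exists ((l *m A) 0 j).
exact: cvg_lim h.
Qed.

End ComplexDerivatives.

(** * The equation on coinvariants *)

Section Equation.
Context (R : realType).
Local Notation C := (Cx R).
Local Notation V := 'rV[C]_(coinv_dim R).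

Definition hat1 (u : V) : C := (u *m Phi R) 0 0.
Definition hat2 (u : V) : C := (u *m Phi R) 0 1.

(* The logarithmic derivatives at z in the direction w of z12 z34, z13 z24 and
   z14 z23, whose entries are numbered from 0 here. *)
Definition dlog12 (z w : 'rV[C]_4) : C :=
  (w 0 0 - w 0 1) / (z 0 0 - z 0 1) + (w 0 2 - w 0 3) / (z 0 2 - z 0 3).
Definition dlog13 (z w : 'rV[C]_4) : C :=
  (w 0 0 - w 0 2) / (z 0 0 - z 0 2) + (w 0 1 - w 0 3) / (z 0 1 - z 0 3).
Definition dlog14 (z w : 'rV[C]_4) : C :=
  (w 0 0 - w 0 3) / (z 0 0 - z 0 3) + (w 0 1 - w 0 2) / (z 0 1 - z 0 2).

Lemma sum_ord4 (F : 'I_4 -> C) : \sum_j F j = F 0 + F 1 + F 2 + F 3.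
Proof.
rewrite !big_ord_recl big_ord0 addr0 !addrA.
by congr (_ + F _ + F _ + F _); exact: val_inj.
Qed.

Lemma sum_neq4 (F : 'I_4 -> 'I_4 -> C) : \sum_j \sum_(k | k != j) F j k =
  F 0 1 + F 0 2 + F 0 3 + (F 1 0 + F 1 2 + F 1 3) +
  (F 2 0 + F 2 1 + F 2 3) + (F 3 0 + F 3 1 + F 3 2).
Proof.
rewrite sum_ord4; congr (_ + _ + _ + _); rewrite big_mkcond sum_ord4 /=;
  by rewrite ?add0r ?addr0.
Qed.

(** The two orders of a pair combine into the logarithmic derivative of z_jk along [w], and
    complementary pairs have equal coefficients; so each of the three splittings contributes the
    logarithmic derivative of one product. *)
Lemma sum_pairing (z w : 'rV[C]_4) (X : 'I_4 -> 'I_4 -> C) (e : nat -> C) :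
  (forall j k : 'I_4, j != k -> X j k = e (pairing j k)) ->
  \sum_j \sum_(k < 4 | k != j) w 0 j * (- 3^-1 * ((z 0 j - z 0 k)^-1 * X j k)) =
  - 3^-1 * (dlog12 z w * e 0%N + dlog13 z w * e 1%N + dlog14 z w * e 2%N).
Proof.
move=> XE; rewrite sum_neq4.
rewrite (XE 0 1 isT : X 0 1 = e 0%N).
rewrite (XE 0 2 isT : X 0 2 = e 1%N).
rewrite (XE 0 3 isT : X 0 3 = e 2%N).
rewrite (XE 1 0 isT : X 1 0 = e 0%N).
rewrite (XE 1 2 isT : X 1 2 = e 2%N).
rewrite (XE 1 3 isT : X 1 3 = e 1%N).
rewrite (XE 2 0 isT : X 2 0 = e 1%N).
rewrite (XE 2 1 isT : X 2 1 = e 2%N).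
rewrite (XE 2 3 isT : X 2 3 = e 0%N).
rewrite (XE 3 0 isT : X 3 0 = e 2%N).
rewrite (XE 3 1 isT : X 3 1 = e 1%N).
rewrite (XE 3 2 isT : X 3 2 = e 0%N).
have opp (j k : 'I_4) : (z 0 j - z 0 k)^-1 = - (z 0 k - z 0 j)^-1.
  by rewrite -invrN opprB.
rewrite (opp 1 0) (opp 2 0) (opp 3 0) (opp 2 1) (opp 3 1) (opp 3 2).
rewrite /dlog12 /dlog13 /dlog14.
set A := (z 0 0 - z 0 1)^-1; set A' := (z 0 0 - z 0 2)^-1; set A'' := (z 0 0 - z 0 3)^-1.
set B := (z 0 1 - z 0 2)^-1; set B' := (z 0 1 - z 0 3)^-1; set B'' := (z 0 2 - z 0 3)^-1.
ring.
Qed.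

Lemma conf4_neq (z : 'rV[C]_4) (j k : 'I_4) : conf4 z -> j != k -> z 0 j - z 0 k != 0.
Proof. by move=> cz jk; rewrite subr_eq0; exact: cz. Qed.

Lemma KZ_derive (U : set 'rV[C]_4) (u : 'rV[C]_4 -> V) (z w : 'rV[C]_4) :
  KZ_flat_on 3 U u -> U z ->
  let a := dlog12 z w in let b := dlog13 z w in let c := dlog14 z w in
  is_derive (0 : C) (1 : C) (fun t => hat1 (u (z + t *: w)))
    (hat1 (u z) * (a / 2 - b / 6 + c / 6) + hat2 (u z) * (b - c) / 3) /\
  is_derive (0 : C) (1 : C) (fun t => hat2 (u (z + t *: w)))
    (hat1 (u z) * (a - c) / 3 + hat2 (u z) * (- a / 6 + b / 2 + c / 6)).
Proof.
move=> [oU Uconf fl] Uz a b c; have [du ue] := fl z Uz.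
have cz := Uconf z Uz.
pose G j := - 3^-1 *: (\sum_(k < 4 | k != j)
              (z 0 j - z 0 k)^-1 *: (u z *m coinv_op (Omega R j k))).
(* Differentiability turns the four partial equations into one for every direction [w]. *)
have dE : 'D_w u z = \sum_j w 0 j *: G j.
  rewrite deriveE // {1}(row_sum_delta w) linear_sum; apply: eq_bigr => j _.
  rewrite linearZ /= -deriveE //; congr (_ *: _).
  by apply/eqP; rewrite /G scaleNr -subr_eq0 opprK; apply/eqP; exact: ue.
have hE (i : 'I_2) : ('D_w u z *m Phi R) 0 i = \sum_j \sum_(k < 4 | k != j)
    w 0 j * (- 3^-1 * ((z 0 j - z 0 k)^-1 * (u z *m coinv_op (Omega R j k) *m Phi R) 0 i)).
  rewrite dE mulmx_suml summxE; apply: eq_bigr => j _.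
  rewrite /G -!scalemxAl mulmx_suml !mxE -!mulr_sumr; congr (_ * (_ * _)).
  by rewrite summxE; apply: eq_bigr => k _; rewrite -scalemxAl mxE.
have D := derivableP (diff_derivable (v := w) du).
have z10 : z 0 0 - z 0 1 != 0 by exact: conf4_neq.
have z20 : z 0 0 - z 0 2 != 0 by exact: conf4_neq.
have z30 : z 0 0 - z 0 3 != 0 by exact: conf4_neq.
have z21 : z 0 1 - z 0 2 != 0 by exact: conf4_neq.
have z31 : z 0 1 - z 0 3 != 0 by exact: conf4_neq.
have z32 : z 0 2 - z 0 3 != 0 by exact: conf4_neq.
have E (i : 'I_2) (e : nat -> C) : (forall j k : 'I_4, j != k ->
      (u z *m coinv_op (Omega R j k) *m Phi R) 0 i = e (pairing j k)) ->
    ('D_w u z *m Phi R) 0 i = - 3^-1 * (a * e 0%N + b * e 1%N + c * e 2%N).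
  by move=> eE; rewrite hE; exact: sum_pairing.
split; apply: is_derive_eq (is_derive_entry (Phi R) _ D) _.
  rewrite (E _ (fun p => (Omega_coef R p).1.1 * hat1 (u z) + (Omega_coef R p).1.2 * hat2 (u z))).
    by rewrite /=; field.
  by move=> j k jk; have [] := coinv_op_Phi (u z) jk.
rewrite (E _ (fun p => (Omega_coef R p).2.1 * hat1 (u z) + (Omega_coef R p).2.2 * hat2 (u z))).
  by rewrite /=; field.
by move=> j k jk; have [] := coinv_op_Phi (u z) jk.
Qed.

Definition plu1 (z : 'rV[C]_4) : C := (z 0 0 - z 0 1) * (z 0 2 - z 0 3).
Definition plu2 (z : 'rV[C]_4) : C := (z 0 0 - z 0 2) * (z 0 1 - z 0 3).

Lemma is_derive_coordB (z w : 'rV[C]_4) (j k : 'I_4) :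
  is_derive (0 : C) (1 : C) (fun t => (z + t *: w) 0 j - (z + t *: w) 0 k) (w 0 j - w 0 k).
Proof.
have -> : (fun t : C => (z + t *: w) 0 j - (z + t *: w) 0 k) =
    (fun t : C => (z 0 j - z 0 k) + (w 0 j - w 0 k) *: t).
  by apply/funext => t; rewrite !mxE /GRing.scale /=; ring.
have D : is_derive (0 : C) (1 : C) (fun t : C => (w 0 j - w 0 k) *: t) ((w 0 j - w 0 k) *: 1).
  exact: is_deriveZ.
have [] := is_deriveD (is_derive_cst (z 0 j - z 0 k) (0 : C) (1 : C)) D.
by rewrite add0r [_%:A]mulr1 => d e; split; [exact: d|exact: e].
Qed.

(* [logderive f x l] allows [f x = 0], unlike [f'/f = l]. *)
Definition logderive (f : C -> C) (x l : C) := is_derive x (1 : C) f (l * f x).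

Lemma logderiveM f g x l m : logderive f x l -> logderive g x m ->
  logderive (fun t => f t * g t) x (l + m).
Proof.
move=> df dg; rewrite /logderive; have [d e] := is_deriveM df dg.
split; first exact: d.
by rewrite [LHS]e /GRing.scale /=; ring.
Qed.

Lemma logderive_id f x l m : logderive f x l -> l = m -> logderive f x m.
Proof. by move=> ? <-. Qed.

Lemma logderiveX f x l n : logderive f x l -> logderive (fun t => f t ^+ n) x (n%:R * l).
Proof.
move=> df; elim: n => [|n IHn].
  rewrite /logderive !mul0r; exact: is_derive_cst.
have -> : (fun t => f t ^+ n.+1) = (fun t => f t * f t ^+ n).
  by apply/funext => t; rewrite exprS.
by apply: logderive_id (logderiveM df IHn) _; rewrite -natr1; ring.
Qed.

Lemma logderiveV f x l : f x != 0 -> logderive f x l ->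
  logderive (fun t => (f t)^-1) x (- l).
Proof.
move=> f0 [d e]; split; first exact: derivableV.
by rewrite deriveV // e /GRing.scale /=; field.
Qed.

Lemma logderive_coordB (z w : 'rV[C]_4) (j k : 'I_4) : z 0 j - z 0 k != 0 ->
  logderive (fun t => (z + t *: w) 0 j - (z + t *: w) 0 k) 0
    ((w 0 j - w 0 k) / (z 0 j - z 0 k)).
Proof.
move=> zjk; rewrite /logderive !scale0r !addr0 divfK //.
exact: is_derive_coordB.
Qed.

Lemma plu1_logderive (z w : 'rV[C]_4) : conf4 z ->
  logderive (fun t => plu1 (z + t *: w)) 0 (dlog12 z w).
Proof. by move=> cz; apply: logderiveM; apply: logderive_coordB; exact: conf4_neq. Qed.

Lemma plu2_logderive (z w : 'rV[C]_4) : conf4 z ->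
  logderive (fun t => plu2 (z + t *: w)) 0 (dlog13 z w).
Proof. by move=> cz; apply: logderiveM; apply: logderive_coordB; exact: conf4_neq. Qed.

Definition plu3 (z : 'rV[C]_4) : C := (z 0 0 - z 0 3) * (z 0 1 - z 0 2).

Lemma plu3_logderive (z w : 'rV[C]_4) : conf4 z ->
  logderive (fun t => plu3 (z + t *: w)) 0 (dlog14 z w).
Proof. by move=> cz; apply: logderiveM; apply: logderive_coordB; exact: conf4_neq. Qed.

Lemma plu_rel z : plu3 z = plu2 z - plu1 z.
Proof. by rewrite /plu1 /plu2 /plu3; ring. Qed.

(** This is [plu_rel] differentiated in the direction [w]. *)
Lemma plu_dlog z w : conf4 z ->
  plu3 z * dlog14 z w = plu2 z * dlog13 z w - plu1 z * dlog12 z w.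
Proof.
move=> cz; rewrite /plu1 /plu2 /plu3 /dlog12 /dlog13 /dlog14.
field.
by do !(apply/andP; split); exact: conf4_neq.
Qed.

Lemma plu1_neq0 z : conf4 z -> plu1 z != 0.
Proof. by move=> cz; rewrite mulf_neq0 // conf4_neq. Qed.
Lemma plu2_neq0 z : conf4 z -> plu2 z != 0.
Proof. by move=> cz; rewrite mulf_neq0 // conf4_neq. Qed.
Lemma plu3_neq0 z : conf4 z -> plu3 z != 0.
Proof. by move=> cz; rewrite mulf_neq0 // conf4_neq. Qed.

Definition disc (z : 'rV[C]_4) : C := plu1 z * plu2 z * plu3 z.

Lemma disc_logderive (z w : 'rV[C]_4) : conf4 z ->
  logderive (fun t => disc (z + t *: w)) 0 (dlog12 z w + dlog13 z w + dlog14 z w).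
Proof.
move=> cz; apply: logderiveM (plu3_logderive w cz).
exact: logderiveM (plu1_logderive w cz) (plu2_logderive w cz).
Qed.

Lemma disc_neq0 z : conf4 z -> disc z != 0.
Proof.
move=> cz; apply: mulf_neq0 (plu3_neq0 cz).
exact: mulf_neq0 (plu1_neq0 cz) (plu2_neq0 cz).
Qed.

(* Its zeros are the line of the conformal block (plu1 z, plu2 z). *)
Definition blockf (z : 'rV[C]_4) (v : V) : C := plu1 z * hat2 v - plu2 z * hat1 v.
Definition wronsk (r s : V) : C := hat1 r * hat2 s - hat2 r * hat1 s.

Section Flat.
Variables (U : set 'rV[C]_4) (z w : 'rV[C]_4) (u v : 'rV[C]_4 -> V).
Hypotheses (fu : KZ_flat_on 3 U u) (fv : KZ_flat_on 3 U v) (Uz : U z).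

Let cz : conf4 z. Proof. by case: fu => _ + _; apply. Qed.

(** [blockf] is the determinant against the conformal block, a coordinate on the quotient by the
    invariant line. Its exponent 1/2 is the eigenvalue of [- Omega / 3] where the exchange of
    factors is -1; the line itself takes the other eigenvalue, -1/6. *)
Lemma blockf_logderive :
  logderive (fun t => blockf (z + t *: w) (u (z + t *: w))) 0
    ((dlog12 z w + dlog13 z w + dlog14 z w) / 2).
Proof.
have [d1 d2] := KZ_derive w fu Uz.
have := is_deriveB (is_deriveM (plu1_logderive w cz) d2) (is_deriveM (plu2_logderive w cz) d1).
move=> [d e]; split; first exact: d.
rewrite [LHS]e !scale0r !addr0 /GRing.scale /= /blockf.
have := plu_dlog w cz; rewrite plu_rel.
move: (plu1 z) (plu2 z) (dlog12 z w) (dlog13 z w) (dlog14 z w) (hat1 (u z)) (hat2 (u z)).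
move=> p q a b c x y rel.
(* What differs from the expected value is a multiple of [plu_dlog], hence zero. *)
have -> : p * (x * (a - c) / 3 + y * (- a / 6 + b / 2 + c / 6)) + y * (a * p) -
   (q * (x * (a / 2 - b / 6 + c / 6) + y * (b - c) / 3) + x * (b * q)) =
   (a + b + c) / 2 * (p * y - q * x) - (x + y) / 3 * ((q * b - p * a) - (q - p) * c).
  by field.
by rewrite rel subrr mulr0 subr0.
Qed.

(** Liouville's formula: in the coordinates [hat1], [hat2] every [Omega] has trace -1, and the
    connection multiplies it by -1/3. *)
Lemma wronsk_logderive :
  logderive (fun t => wronsk (u (z + t *: w)) (v (z + t *: w))) 0
    ((dlog12 z w + dlog13 z w + dlog14 z w) / 3).
Proof.
have [d1 d2] := KZ_derive w fu Uz; have [e1 e2] := KZ_derive w fv Uz.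
have := is_deriveB (is_deriveM d1 e2) (is_deriveM d2 e1).
move=> [d e]; split; first exact: d.
rewrite [LHS]e !scale0r !addr0 /GRing.scale /= /wronsk; by field.
Qed.

(** On the invariant line, solutions are multiples of the block, and the rate is that of
    [plu1 * disc^(-1/6)]. *)
Lemma hat1_logderive : blockf z (u z) = 0 ->
  logderive (fun t => hat1 (u (z + t *: w))) 0
    ((5 * dlog12 z w - dlog13 z w - dlog14 z w) / 6).
Proof.
move=> y0; have [d1 _] := KZ_derive w fu Uz.
apply: is_derive_eq d1 _; rewrite !scale0r !addr0.
have := plu_dlog w cz; rewrite plu_rel.
have := plu1_neq0 cz; move: y0; rewrite /blockf.
move: (plu1 z) (plu2 z) (dlog12 z w) (dlog13 z w) (dlog14 z w) (hat1 (u z)) (hat2 (u z)).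
move=> p q a b c x y y0 p0 rel; apply: (mulfI p0); apply/eqP; rewrite -subr_eq0.
have -> : p * (x * (a / 2 - b / 6 + c / 6) + y * (b - c) / 3) -
    p * ((5 * a - b - c) / 6 * x) =
    (b - c) / 3 * (p * y - q * x) + x / 3 * ((q * b - p * a) - (q - p) * c).
  by field.
by rewrite y0 rel subrr !mulr0 addr0.
Qed.

End Flat.
End Equation.

(** * First integrals along a continuation *)

Lemma eq0_sqr_div (F : fieldType) (x y d e : F) : d != 0 -> e != 0 ->
  x ^+ 2 / d = y ^+ 2 / e -> (x == 0) = (y == 0).
Proof.
move=> d0 e0 h; apply/eqP/eqP => z0; move: h; rewrite z0 expr0n mul0r.
  by move/esym/eqP; rewrite mulf_eq0 invr_eq0 (negbTE e0) orbF expf_eq0 => /eqP.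
by move/eqP; rewrite mulf_eq0 invr_eq0 (negbTE d0) orbF expf_eq0 => /eqP.
Qed.

Section Invariants.
Context (R : realType).
Local Notation C := (Cx R).
Local Notation V := 'rV[C]_(coinv_dim R).

Definition KZ_along (a : R -> 'rV[C]_4) (s : R -> V) : Prop :=
  forall t : R, t \in `[0, 1] -> exists U u, [/\ KZ_flat_on 3 U u, U (a t) &
     \forall t' \near t, t' \in `[0, 1] -> s t' = u (a t')].

Lemma KZ_continuationP a v w : KZ_continuation 3 a v w <->
  exists s, [/\ KZ_along a s, s 0 = v & s 1 = w].
Proof. by split=> [[s [? ? ?]]|[s [? ? ?]]]; exists s. Qed.

Lemma KZ_flat_onS (U U' : set 'rV[C]_4) u : open U' -> U' `<=` U ->
  KZ_flat_on 3 U u -> KZ_flat_on (R := R) 3 U' u.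
Proof.
move=> oU' UU' [_ Uc fl]; split=> //; first by move=> z /UU'/Uc.
by move=> z /UU'/fl.
Qed.

Lemma KZ_along2 a r s : KZ_along a r -> KZ_along a s ->
  forall t : R, t \in `[0, 1] -> exists U u v,
   [/\ KZ_flat_on 3 U u, KZ_flat_on 3 U v, U (a t) &
     \forall t' \near t, t' \in `[0, 1] -> r t' = u (a t') /\ s t' = v (a t')].
Proof.
move=> ar as_ t t01; have [U [u [fu Ut ru]]] := ar t t01.
have [U' [u' [fu' Ut' ru']]] := as_ t t01.
have oUU' : open (U `&` U') by apply: openI; [case: fu|case: fu'].
exists (U `&` U'), u, u'; split => //.
- by apply: KZ_flat_onS fu => // z [].
- by apply: KZ_flat_onS fu' => // z [].
- by apply: filterS2 ru ru' => t' h h' i; rewrite h ?h'.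
Qed.

Lemma KZ_along_conf a s (t : R) : KZ_along a s -> t \in `[0, 1] -> conf4 (a t).
Proof. by move=> h /h[U [u [[_ Uc _] /Uc]]]. Qed.

Lemma along_near (a : R -> 'rV[C]_4) (U : set 'rV[C]_4) (t : R) : {within `[0, 1], continuous a} ->
  t \in `[0, 1] -> (\forall z \near a t, U z) ->
  \forall t' \near t, t' \in `[0, 1] -> U (a t').
Proof.
move=> /subspace_continuousP ca t01 h.
have H : within `[0, 1] (nbhs t) [set t' | U (a t')] := ca t t01 U h.
exact: H.
Qed.

(** Near each time the two continuations are restrictions of flat sections, so a conserved quantity
    of flat sections is locally constant in time. [P] is a side condition known along the whole
    path: [hat1] has a conservation law only inside the invariant line. *)
Lemma along_constant (P : 'rV[C]_4 -> V -> V -> Prop) (F : 'rV[C]_4 -> V -> V -> C)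
    (a : R -> 'rV[C]_4) (r s : R -> V) :
  {within `[0, 1], continuous a} ->
  (forall U u v z, KZ_flat_on 3 U u -> KZ_flat_on 3 U v -> U z -> P z (u z) (v z) ->
    \forall z' \near z, F z' (u z') (v z') = F z (u z) (v z)) ->
  KZ_along a r -> KZ_along a s ->
  (forall t : R, t \in `[0, 1] -> P (a t) (r t) (s t)) ->
  forall t : R, t \in `[0, 1] -> F (a t) (r t) (s t) = F (a 0) (r 0) (s 0).
Proof.
move=> ca HF ar as_ HP; apply: (@locally_constant R C (fun t => F (a t) (r t) (s t))) => t t01.
have [U [u [v [fu fv Ut h]]]] := KZ_along2 ar as_ t01.
have [rt st] := nbhs_singleton h t01.
have Pt := HP t t01; rewrite rt st in Pt.
have := along_near ca t01 (HF _ _ _ _ fu fv Ut Pt).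
apply: filterS2 h => t' h h' i; have [-> ->] := h i; rewrite h' //.
by rewrite rt st.
Qed.

Lemma blockf_constant U (u : 'rV[C]_4 -> V) z : KZ_flat_on 3 U u -> U z ->
  \forall z' \near z, blockf z' (u z') ^+ 2 / disc z' = blockf z (u z) ^+ 2 / disc z.
Proof.
move=> fu Uz; have [oU Uc _] := fu.
apply: (line_constant (H := fun z => blockf z (u z) ^+ 2 / disc z) oU) Uz => z' w Uz'.
have cz := Uc _ Uz'.
have d0 : disc (z' + 0 *: w) != 0 by rewrite scale0r addr0; exact: disc_neq0.
have := logderiveM (logderiveX 2 (blockf_logderive w fu Uz')) (logderiveV (f := fun t => disc (z' + t *: w)) d0 (disc_logderive w cz)).
move=> h; have := logderive_id h _; move=> /(_ 0); rewrite /logderive mul0r; apply.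
by field.
Qed.

Lemma wronsk_constant U (u v : 'rV[C]_4 -> V) z : KZ_flat_on 3 U u -> KZ_flat_on 3 U v -> U z ->
  \forall z' \near z, wronsk (u z') (v z') ^+ 3 / disc z' = wronsk (u z) (v z) ^+ 3 / disc z.
Proof.
move=> fu fv Uz; have [oU Uc _] := fu.
apply: (line_constant (H := fun z => wronsk (u z) (v z) ^+ 3 / disc z) oU) Uz => z' w Uz'.
have cz := Uc _ Uz'.
have d0 : disc (z' + 0 *: w) != 0 by rewrite scale0r addr0; exact: disc_neq0.
have := logderiveM (logderiveX 3 (wronsk_logderive w fu fv Uz')) (logderiveV (f := fun t => disc (z' + t *: w)) d0 (disc_logderive w cz)).
move=> h; have := logderive_id h _; move=> /(_ 0); rewrite /logderive mul0r; apply.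
by field.
Qed.

Lemma hat1_constant U (u : 'rV[C]_4 -> V) z : KZ_flat_on 3 U u -> U z -> blockf z (u z) = 0 ->
  \forall z' \near z, hat1 (u z') ^+ 6 * disc z' / plu1 z' ^+ 6 =
    hat1 (u z) ^+ 6 * disc z / plu1 z ^+ 6.
Proof.
move=> fu Uz y0; have [oU Uc _] := fu.
(* The hypothesis puts [u] in the invariant line at [z] only; conservation of [blockf^2 / disc]
   spreads this to a neighbourhood, where [hat1] can be differentiated. *)
have [U' [oU' U'U U'z U'0]] : exists U', [/\ open U', U' `<=` U, U' z &
   forall z, U' z -> blockf z (u z) = 0].
  have := blockf_constant fu Uz; rewrite y0 expr0n mul0r => /nbhs_interior h.
  exists (U `&` (fun z' => blockf z' (u z') ^+ 2 / disc z' = 0)^°).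
  split.
  - exact: openI oU (@open_interior _ _).
  - by move=> x [Ux _].
  - exact: (conj Uz (nbhs_singleton h)).
  - move=> z' [Uz' /interior_subset e]; have cz' := Uc _ Uz'.
    have /eqP : blockf z' (u z') ^+ 2 / disc z' = 0 := e.
    rewrite mulf_eq0 expf_eq0 invr_eq0 (negbTE (disc_neq0 cz')) orbF.
    by move=> /andP[_ /eqP].
apply: (line_constant (H := fun z => hat1 (u z) ^+ 6 * disc z / plu1 z ^+ 6) oU') U'z => z' w U'z'.
have Uz' := U'U _ U'z'; have cz := Uc _ Uz'.
have d0 : plu1 (z' + 0 *: w) ^+ 6 != 0.
  by rewrite scale0r addr0 expf_neq0 // plu1_neq0.
have := logderiveM (logderiveM (logderiveX 6 (hat1_logderive w fu Uz' (U'0 _ U'z')))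
   (disc_logderive w cz)) (logderiveV (f := fun t => plu1 (z' + t *: w) ^+ 6) d0 (logderiveX 6 (plu1_logderive w cz))).
move=> h; have := logderive_id h _; move=> /(_ 0); rewrite /logderive mul0r; apply.
by field.
Qed.

Section Along.
Variables (a : R -> 'rV[C]_4) (r s : R -> V).
Hypotheses (ca : {within `[0, 1], continuous a}) (ar : KZ_along a r) (as_ : KZ_along a s).

Lemma along_blockf (t : R) : t \in `[0, 1] ->
  blockf (a t) (r t) ^+ 2 / disc (a t) = blockf (a 0) (r 0) ^+ 2 / disc (a 0).
Proof.
apply: (along_constant (P := fun _ _ _ => True)
  (F := fun z v _ => blockf z v ^+ 2 / disc z) ca _ ar ar) => // U u _ z fu _ Uz _.
exact: blockf_constant fu Uz.
Qed.

Lemma along_wronsk (t : R) : t \in `[0, 1] ->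
  wronsk (r t) (s t) ^+ 3 / disc (a t) = wronsk (r 0) (s 0) ^+ 3 / disc (a 0).
Proof.
apply: (along_constant (P := fun _ _ _ => True)
  (F := fun z v v' => wronsk v v' ^+ 3 / disc z) ca _ ar as_) => // U u v z fu fv Uz _.
exact: wronsk_constant fu fv Uz.
Qed.

Lemma along_block (t : R) : t \in `[0, 1] -> (blockf (a t) (r t) == 0) = (blockf (a 0) (r 0) == 0).
Proof.
move=> t01; have e := along_blockf t01.
have i0 : (0 : R) \in `[0, 1] by rewrite in_itv /= lexx ler01.
have dt := disc_neq0 (KZ_along_conf ar t01).
have d0 := disc_neq0 (KZ_along_conf ar i0).
exact: eq0_sqr_div dt d0 e.
Qed.

Lemma along_hat1 (t : R) : t \in `[0, 1] -> blockf (a 0) (r 0) = 0 ->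
  hat1 (r t) ^+ 6 * disc (a t) / plu1 (a t) ^+ 6 =
  hat1 (r 0) ^+ 6 * disc (a 0) / plu1 (a 0) ^+ 6.
Proof.
move=> t01 y0; move: t t01; apply: (along_constant (P := fun z v _ => blockf z v = 0)
  (F := fun z v _ => hat1 v ^+ 6 * disc z / plu1 z ^+ 6) ca _ ar ar).
  by move=> U u _ z fu _ Uz; exact: hat1_constant fu Uz.
by move=> t /along_block; rewrite y0 eqxx => /eqP.
Qed.

End Along.
End Invariants.

(** * Reparametrization, concatenation and linearity of continuations *)

Section Continuation.
Context (R : realType).
Local Notation C := (Cx R).
Local Notation V := 'rV[C]_(coinv_dim R).

Lemma KZ_along_reparam (a b : R -> 'rV[C]_4) (s : R -> V) (phi : R -> R) :
  continuous phi -> (forall t : R, t \in `[0, 1] -> phi t \in `[0, 1]) ->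
  (forall t : R, t \in `[0, 1] -> b t = a (phi t)) ->
  KZ_along a s -> KZ_along b (fun t => s (phi t)).
Proof.
move=> cphi Iphi bE as_ t t01; have [U [u [fu Ut h]]] := as_ _ (Iphi t t01).
exists U, u; split => //; first by rewrite bE.
have : \forall t' \near t, phi t' \in `[0, 1] -> s (phi t') = u (a (phi t')) := cphi t _ h.
apply: filterS => t' ht' i.
by rewrite /= ht' ?bE //; exact: Iphi.
Qed.

Lemma KZ_flat_on_lin (U : set 'rV[C]_4) (u v : 'rV[C]_4 -> V) (k : C) :
  KZ_flat_on 3 U u -> KZ_flat_on 3 U v ->
  KZ_flat_on 3 U (fun z => k *: u z + v z).
Proof.
move=> [oU Uc fu] [_ _ fv]; split; [exact: oU|exact: Uc|move=> z Uz].
have [du eu] := fu z Uz; have [dv ev] := fv z Uz.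
have dku : differentiable (k \*: u) z by exact: differentiableZ.
split; first exact: differentiableD.
move=> j; have := eu j; have := ev j.
rewrite (deriveD (f := k \*: u)); [|exact: diff_derivable|exact: diff_derivable].
rewrite deriveZ; last exact: diff_derivable.
have E : \sum_(k0 < 4 | k0 != j) (z 0 j - z 0 k0)^-1 *: ((k *: u z + v z) *m coinv_op (Omega R j k0)) =
  k *: (\sum_(k0 < 4 | k0 != j) (z 0 j - z 0 k0)^-1 *: (u z *m coinv_op (Omega R j k0))) +
  \sum_(k0 < 4 | k0 != j) (z 0 j - z 0 k0)^-1 *: (v z *m coinv_op (Omega R j k0)).
  rewrite scaler_sumr -big_split; apply: eq_bigr => l _ /=.
  by rewrite mulmxDl scalerDr -scalemxAl !scalerA (mulrC k).
rewrite E => h1 h2; rewrite scalerDr addrACA h1 addr0 scalerA (mulrC _ k) -scalerA -scalerDr.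
by rewrite h2 scaler0.
Qed.

Lemma KZ_along_lin (a : R -> 'rV[C]_4) (r s : R -> V) (k : C) : KZ_along a r -> KZ_along a s ->
  KZ_along a (fun t => k *: r t + s t).
Proof.
move=> ar as_ t t01; have [U [u [v [fu fv Ut h]]]] := KZ_along2 ar as_ t01.
exists U, (fun z => k *: u z + v z); split; [exact: KZ_flat_on_lin|exact: Ut|].
by apply: filterS h => t' h i; have [-> ->] := h i.
Qed.

Definition pcat (T : Type) (a b : R -> T) (t : R) : T :=
  if t <= 2^-1 then a (2 * t) else b (2 * t - 1).

Lemma continuous_affine (u v : R) : continuous (fun t : R => u * t + v).
Proof.
move=> t; apply: cvgD; last exact: cvg_cst.
by apply: cvgM; [exact: cvg_cst|exact: cvg_id].
Qed.

Lemma KZ_along_pcat (a b : R -> 'rV[C]_4) (s : R -> V) : a 1 = b 0 ->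
  KZ_along (pcat a b) s ->
  KZ_along a (fun t => s (2^-1 * t + 0)) /\ KZ_along b (fun t => s (2^-1 * t + 2^-1)).
Proof.
move=> ab h; split.
  apply: (KZ_along_reparam (@continuous_affine 2^-1 0) _ _ h) => t.
    by rewrite !in_itv /= => /andP[t0 t1]; apply/andP; split; lra.
  rewrite in_itv /= => /andP[t0 t1]; rewrite /pcat ifT; last lra.
  by congr (a _); lra.
apply: (KZ_along_reparam (@continuous_affine 2^-1 2^-1) _ _ h) => t.
  by rewrite !in_itv /= => /andP[t0 t1]; apply/andP; split; lra.
rewrite in_itv /= => /andP[t0 t1]; rewrite /pcat; case: ifP => h'.
  have -> : t = 0 by lra.
  by rewrite -ab; congr (a _); lra.
by congr (b _); lra.
Qed.

Lemma KZ_continuation_pcat (a b : R -> 'rV[C]_4) (v w : V) : a 1 = b 0 ->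
  KZ_continuation 3 (pcat a b) v w ->
  exists x, KZ_continuation 3 a v x /\ KZ_continuation 3 b x w.
Proof.
move=> ab /KZ_continuationP[s [h sv sw]].
have [ha hb] := KZ_along_pcat ab h; exists (s 2^-1); split; apply/KZ_continuationP.
  exists (fun t => s (2^-1 * t + 0)); split; first exact: ha.
    by rewrite mulr0 addr0.
  by congr s; lra.
exists (fun t => s (2^-1 * t + 2^-1)); split; first exact: hb.
  by congr s; lra.
by rewrite -sw; congr s; lra.
Qed.

Lemma KZ_continuation_rev (a b : R -> 'rV[C]_4) (v w : V) :
  (forall t : R, t \in `[0, 1] -> b t = a (1 - t)) ->
  KZ_continuation 3 a v w -> KZ_continuation 3 b w v.
Proof.
move=> bE /KZ_continuationP[s [h sv sw]]; apply/KZ_continuationP.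
exists (fun t => s (-1 * t + 1)); split.
- apply: (KZ_along_reparam (@continuous_affine (-1) 1) _ _ h) => t.
    by rewrite !in_itv /= => /andP[t0 t1]; apply/andP; split; lra.
  by move=> /bE ->; congr a; lra.
- by rewrite mulr0 add0r.
- by rewrite mulr1 addNr.
Qed.

Lemma KZ_continuation_lin (a : R -> 'rV[C]_4) (v w v' w' : V) k :
  KZ_continuation 3 a v w -> KZ_continuation 3 a v' w' ->
  KZ_continuation 3 a (k *: v + v') (k *: w + w').
Proof.
move=> /KZ_continuationP[r [h rv rw]] /KZ_continuationP[s [h' sv sw]].
apply/KZ_continuationP; exists (fun t => k *: r t + s t).
by split; [exact: KZ_along_lin|rewrite rv sv|rewrite rw sw].
Qed.

End Continuation.

(** * An affine slice of the configuration space *)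

Lemma mulf_expf_div_neq0 (F : fieldType) n (x y z : F) :
  x != 0 -> y != 0 -> z != 0 -> x ^+ n * y / z ^+ n != 0.
Proof. by move=> x0 y0 z0; rewrite !mulf_neq0 ?invr_neq0 ?expf_neq0. Qed.

Section Slice.
Context (R : realType).
Local Notation C := (Cx R).
Local Notation V := 'rV[C]_(coinv_dim R).

Definition seg (p q : 'rV[C]_4) (t : R) : 'rV[C]_4 := p + rc t *: (q - p).

(* The points (4b, 0, 6b - 2t, 3b - t) with b = 123. *)
Definition slice (t : C) : 'rV[C]_4 :=
  \row_(j < 4) nth 0 [:: 492; 0; 738 - 2 * t; 369 - t] j.

Definition slice_dir : 'rV[C]_4 := \row_(j < 4) nth 0 [:: 0; 0; -2; -1] j.

Lemma slice_add t c : slice (t + c) = slice t + c *: slice_dir.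
Proof.
apply/rowP => j; rewrite !mxE.
case: j => -[|[|[|[|//]]]] jl /=; ring.
Qed.

Lemma slice_seg A B t : seg (slice A) (slice B) t = slice A + rc t *: ((B - A) *: slice_dir).
Proof.
have -> : slice B = slice A + (B - A) *: slice_dir by rewrite -slice_add addrC subrK.
by rewrite /seg [_ + _ - _]addrAC subrr add0r.
Qed.

Lemma slice_segE A B t : seg (slice A) (slice B) t = slice (A + rc t * (B - A)).
Proof. by rewrite slice_seg slice_add scalerA. Qed.

(** The common factor [369 - t] makes the cross-ratio [plu2 / plu1] equal to [(123 - t) / 246],
    affine in [t]. Its values 0 and 1 are the collisions of the first point with the third (t = 123)
    and with the fourth (t = -123); at t = 369 the last three points meet. *)
Lemma slice_plu t : [/\ plu1 (slice t) = 492 * (369 - t),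
   plu2 (slice t) = 2 * (123 - t) * (369 - t) &
   plu3 (slice t) = - 2 * (123 + t) * (369 - t)].
Proof. by rewrite /plu1 /plu2 /plu3 !mxE /=; split; ring. Qed.

Lemma slice_conf t : conf4 (slice t) <-> [/\ t != 123, t != - 123 & t != 369].
Proof.
split=> [cz|[t1 t2 t3]].
  have [e1 e2 e3] := slice_plu t.
  have := plu2_neq0 cz; have := plu3_neq0 cz.
  rewrite e2 e3 !mulf_eq0 !negb_or => /andP[/andP[_ h1] h2] /andP[/andP[_ h3] _].
  split; [move: h3|move: h1|move: h2]; apply: contraNneq => ->; apply/eqP; ring.
have n2 : (2 : C) != 0 by rewrite pnatr_eq0.
have n492 : (492 : C) != 0 by rewrite pnatr_eq0.
have d1 : 123 - t != 0 by rewrite subr_eq0 eq_sym.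
have d2 : 123 + t != 0 by rewrite addrC addr_eq0.
have d3 : 369 - t != 0 by rewrite subr_eq0 eq_sym.
have H (j k : 'I_4) (x : C) : x != 0 -> slice t 0 j - slice t 0 k = x -> slice t 0 j != slice t 0 k.
  by move=> x0 e; rewrite -subr_eq0 e.
have W (j k : 'I_4) : (j < k)%N -> slice t 0 j != slice t 0 k.
  case: j => -[|[|[|[|//]]]] jl; case: k => -[|[|[|[|//]]]] kl // _.
  - by apply: (H _ _ 492) => //; rewrite !mxE /=; ring.
  - by apply: (H _ _ (-2 * (123 - t))); [rewrite mulf_neq0 ?oppr_eq0|rewrite !mxE /=; ring].
  - by apply: (H _ _ (123 + t)) => //; rewrite !mxE /=; ring.
  - by apply: (H _ _ (-2 * (369 - t))); [rewrite mulf_neq0 ?oppr_eq0|rewrite !mxE /=; ring].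
  - by apply: (H _ _ (- (369 - t))); [rewrite oppr_eq0|rewrite !mxE /=; ring].
  - by apply: (H _ _ (369 - t)) => //; rewrite !mxE /=; ring.
move=> j k; rewrite -val_eqE neq_ltn => /orP[] jk; first exact: W.
by rewrite eq_sym; exact: W.
Qed.

(* For sections r, s along [slice], with r in the invariant line, this is the
   derivative in t of [hat1 s / hat1 r]; its cube is a constant over t^2 - 123^2. *)
Definition sg (t : C) (r s : V) : C :=
  82 / (t ^+ 2 - 15129) * (wronsk r s / hat1 r ^+ 2).

(** The terms in [369 - t] cancel and [1/(t - 123) - 1/(t + 123)] is left; 82 is 246 / 3. *)
Lemma slice_dlog t d : conf4 (slice t) ->
  (dlog13 (slice t) (d *: slice_dir) - dlog14 (slice t) (d *: slice_dir)) / 3 =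
  82 / (t ^+ 2 - 15129) * d.
Proof.
move=> cz; rewrite /dlog13 /dlog14 !mxE /=.
have [t1 t2 t3] := (slice_conf t).1 cz.
have h1 : t - 123 != 0 by rewrite subr_eq0.
have h2 : t + 123 != 0 by rewrite addr_eq0.
have h3 : t - 369 != 0 by rewrite subr_eq0.
have -> : t ^+ 2 - 15129 = (t - 123) * (t + 123) by ring.
field.
have h4 : 369 - t != 0 by rewrite -opprB oppr_eq0.
have h5 : 738 - 2 * t != 0.
  by rewrite (_ : 738 - 2 * t = 2 * (369 - t)); [rewrite mulf_neq0 // pnatr_eq0|ring].
have h6 : 492 - (738 - 2 * t) != 0.
  by rewrite (_ : 492 - _ = 2 * (t - 123)); [rewrite mulf_neq0 // pnatr_eq0|ring].
by rewrite h2 h1 h5 h4 h6.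
Qed.

Lemma logderive_line (F : 'rV[C]_4 -> C) (z w : 'rV[C]_4) (c l : C) :
  logderive (fun t => F (z + c *: w + t *: w)) 0 l ->
  logderive (fun t => F (z + t *: w)) c l.
Proof. by move=> h; apply: is_derive_line_translate; move: h; rewrite /logderive scale0r addr0. Qed.

Lemma logderive_quad (A d c : C) : (A + c * d) ^+ 2 - 15129 != 0 ->
  exists l, logderive (fun t : C => (A + t * d) ^+ 2 - 15129) c l.
Proof.
move=> N0; exists ((2 * (A + c * d) * d) / ((A + c * d) ^+ 2 - 15129)).
rewrite /logderive (divfK N0).
have D1 : is_derive c (1 : C) (fun t : C => d *: t) (d *: (1 : C)) by exact: is_deriveZ.
have D2 := is_deriveD (is_derive_cst A c (1 : C)) D1.
have [d3 e3] := is_deriveB (is_deriveM D2 D2) (is_derive_cst (15129 : C) c (1 : C)).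
have -> : (fun t : C => (A + t * d) ^+ 2 - 15129) =
   (cst A + *:%R d) * (cst A + *:%R d) - cst 15129.
  apply/funext => t; rewrite expr2 (mulrC t); exact: erefl.
split; first exact: d3.
rewrite [LHS]e3 /GRing.scale /= !fctE; ring.
Qed.

Lemma cvg_within_near (g h : R -> R) (t : R) : t \in `[0, 1] ->
  (\forall t' \near t, t' \in `[0, 1] -> g t' = h t') ->
  {for t, continuous h} -> g @ within `[0, 1] (nbhs t) --> g t.
Proof.
move=> t01 gh ch; rewrite (nbhs_singleton gh t01).
have H : h @ within `[0, 1] (nbhs t) --> h t by exact: cvg_within_filter ch.
apply: cvg_trans H; apply: near_eq_cvg.
have : \forall t' \near within `[0, 1] (nbhs t), g t' = h t' := gh.
by apply: filterS => t' ->.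
Qed.

(** On the slice [disc] is [1968 (x^2 - 123^2) (369 - x)^3] and [plu1] is [492 (369 - x)]. The sixth
    powers of [369 - x] cancel, and the right side involves only the two conserved quantities. *)
Lemma sg_cube (x : C) (u v : V) : conf4 (slice x) -> hat1 u != 0 ->
   sg x u v ^+ 3 * (x ^+ 2 - 15129) =
   82 ^+ 3 * (1968 ^+ 2 / 492 ^+ 6) * (wronsk u v ^+ 3 / disc (slice x)) /
     (hat1 u ^+ 6 * disc (slice x) / plu1 (slice x) ^+ 6).
Proof.
move=> cx u0; have [x1 x2 x3] := (slice_conf x).1 cx.
have [p1 p2 p3] := slice_plu x.
rewrite /disc p1 p2 p3 /sg.
have n1 : 123 - x != 0 by rewrite subr_eq0 eq_sym.
have n2 : 123 + x != 0 by rewrite addrC addr_eq0.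
have n3 : 369 - x != 0 by rewrite subr_eq0 eq_sym.
have -> : x ^+ 2 - 15129 = - ((123 - x) * (123 + x)) by ring.
move: n1 n2 n3 u0; move: (123 - x) (123 + x) (369 - x) (wronsk u v) (hat1 u).
move=> X1 X2 X3 W h n1 n2 n3 hn; field.
by rewrite n1 n2 n3 hn.
Qed.

Lemma is_derive_inv (f : C -> C) (x df : C) : f x != 0 -> is_derive x (1 : C) f df ->
  is_derive x (1 : C) (fun t => (f t)^-1) (- df / f x ^+ 2).
Proof.
move=> f0 [d e]; split; first exact: derivableV.
by rewrite deriveV // e /GRing.scale /=; field.
Qed.

(** In the quotient rule the diagonal terms of the system cancel; only the coefficient of [hat2] in
    the derivative of [hat1] survives, times the determinant of the two sections. *)
Lemma ratio_derive (U : set 'rV[C]_4) (u v : 'rV[C]_4 -> V) (z w : 'rV[C]_4) :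
  KZ_flat_on 3 U u -> KZ_flat_on 3 U v -> U z -> hat1 (u z) != 0 ->
  is_derive (0 : C) (1 : C) (fun t => hat1 (v (z + t *: w)) / hat1 (u (z + t *: w)))
    ((dlog13 z w - dlog14 z w) / 3 * (wronsk (u z) (v z) / hat1 (u z) ^+ 2)).
Proof.
move=> fu fv Uz u0.
have [d1 _] := KZ_derive w fu Uz; have [e1 _] := KZ_derive w fv Uz.
pose h (t : C) : C := hat1 (u (z + t *: w)).
have h0 : h 0 = hat1 (u z) by rewrite /h scale0r addr0.
have h00 : h 0 != 0 by rewrite h0.
have [d e] := is_deriveM e1 (is_derive_inv (f := h) h00 d1); split; first exact: d.
rewrite [LHS]e h0 !scale0r !addr0 /GRing.scale /= /wronsk; by field.
Qed.

Section Segment.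
Variables (A B : C) (r s : R -> V).
Let a := seg (slice A) (slice B).
Let d := B - A.
Let tt (t : R) : C := A + rc t * d.
Let sig (t : R) : C := sg (tt t) (r t) (s t).
Hypotheses (ar : KZ_along a r) (as_ : KZ_along a s).
Hypotheses (y0 : blockf (slice A) (r 0) = 0) (h0 : hat1 (r 0) != 0).

Lemma seg_continuous (p q : 'rV[C]_4) : continuous (seg p q).
Proof.
move=> t; apply: cvgD; first exact: cvg_cst.
apply: (continuous_comp (g := fun k : C => k *: (q - p))); first exact: continuous_rc.
exact: scalel_continuous.
Qed.

Let ca : {within `[0, 1], continuous a}.
Proof. exact: continuous_subspaceT (@seg_continuous _ _). Qed.

Let aE t : a t = slice (tt t). Proof. exact: slice_segE. Qed.

Let ac (t : R) : t \in `[0, 1] -> conf4 (slice (tt t)).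
Proof. by rewrite -aE; exact: KZ_along_conf ar. Qed.

Let i0 : (0 : R) \in `[0, 1]. Proof. by rewrite in_itv /= lexx ler01. Qed.

Let tt0 : tt 0 = A. Proof. by rewrite /tt mul0r addr0. Qed.

Let ry (t : R) : t \in `[0, 1] -> blockf (slice (tt t)) (r t) = 0.
Proof.
move=> t01; have := along_block ca ar t01; rewrite !aE tt0 y0 eqxx.
by move/eqP.
Qed.

Let e6 (t : R) : t \in `[0, 1] -> hat1 (r t) ^+ 6 * disc (slice (tt t)) / plu1 (slice (tt t)) ^+ 6 =
   hat1 (r 0) ^+ 6 * disc (slice A) / plu1 (slice A) ^+ 6.
Proof.
move=> t01; have := along_hat1 ca ar t01; rewrite !aE tt0; exact.
Qed.

Let rh (t : R) : t \in `[0, 1] -> hat1 (r t) != 0.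
Proof.
move=> t01; have cA : conf4 (slice A) by rewrite -tt0; exact: ac.
have := mulf_expf_div_neq0 6 h0 (disc_neq0 cA) (plu1_neq0 cA).
rewrite -(e6 t01); apply: contraNneq => ->.
by rewrite expr0n !mul0r.
Qed.

Let N0 (t : R) : t \in `[0, 1] -> tt t ^+ 2 - 15129 != 0.
Proof.
move=> /ac/slice_conf[t1 t2 _].
have -> : tt t ^+ 2 - 15129 = (tt t - 123) * (tt t + 123) by ring.
by rewrite mulf_neq0 // ?subr_eq0 // addr_eq0.
Qed.

Lemma segment_sig3 (t : R) : t \in `[0, 1] ->
  sig t ^+ 3 * (tt t ^+ 2 - 15129) = sg A (r 0) (s 0) ^+ 3 * (A ^+ 2 - 15129).
Proof.
have cA : conf4 (slice A) by rewrite -tt0; exact: ac.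
move=> t01; have k1 := sg_cube (s t) (ac t01) (rh t01).
have k2 := sg_cube (s 0) cA h0.
have eW := along_wronsk ca ar as_ t01; rewrite 2!aE tt0 in eW.
apply: etrans k1 _; apply: etrans (esym k2).
exact: (congr2 (fun x y : C => 82 ^+ 3 * (1968 ^+ 2 / 492 ^+ 6) * x / y) eW (e6 t01)).
Qed.

(** [r] and [s] are constrained on [[0, 1]] only. Near [t], their ratio and [sig] are traded for
    functions [f] and [g] built from flat sections on a full neighbourhood, so that derivatives make
    sense at the end points too. *)
Lemma segment_local (t : R) : t \in `[0, 1] -> exists f g : R -> C,
  [/\ \forall t' \near t, t' \in `[0, 1] -> hat1 (s t') / hat1 (r t') = f t' /\ sig t' = g t',
      forall m, {for t, continuous (fun x => re (g x * m))} &
      is_derive t (1 : R) (fun x => re (f x)) (re (sig t * d))].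
Proof.
move=> t01; have [U [u [v [fu fv Ut h]]]] := KZ_along2 ar as_ t01.
have [ru sv] := nbhs_singleton h t01.
pose w := d *: slice_dir.
pose l (c : C) := slice A + c *: w.
have lE (x : R) : a x = l (rc x) by rewrite /l /w /a slice_seg.
have Ul : U (slice A + rc t *: w) by move: Ut; rewrite lE.
have ul : u (slice A + rc t *: w) = r t := etrans (congr1 u (esym (lE t))) (esym ru).
have vl : v (slice A + rc t *: w) = s t := etrans (congr1 v (esym (lE t))) (esym sv).
have lsl : slice A + rc t *: w = slice (tt t) by rewrite -[LHS]lE aE.
have hl : hat1 (u (slice A + rc t *: w)) != 0 by rewrite ul; exact: rh.
have Ncond : (A + rc t * d) ^+ 2 - 15129 != 0 by exact: N0.
exists (fun x => hat1 (v (l (rc x))) / hat1 (u (l (rc x)))),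
  (fun x => sg (tt x) (u (l (rc x))) (v (l (rc x)))); split.
- apply: filterS h => t' h i; have [e1 e2] := h i.
  by rewrite /sig e1 e2 lE.
- move=> m.
  have [l1 L1] := logderive_quad Ncond.
  have L2 := logderive_line (F := fun z => wronsk (u z) (v z)) (wronsk_logderive w fu fv Ul).
  have yl : blockf (slice A + rc t *: w) (u (slice A + rc t *: w)) = 0.
    by rewrite ul lsl; exact: ry.
  have L3 := logderive_line (F := fun z => hat1 (u z)) (hat1_logderive w fu Ul yl).
  have L5 := logderiveV (f := fun c => (A + c * d) ^+ 2 - 15129) Ncond L1.
  have L6 := logderiveV (f := fun c => hat1 (u (slice A + c *: w)) ^+ 2)
    (expf_neq0 2 hl) (logderiveX 2 L3).
  have L4 := logderiveM L5 (logderiveM L2 L6).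
  pose G (c : C) := ((A + c * d) ^+ 2 - 15129)^-1 *
    (wronsk (u (l c)) (v (l c)) * (hat1 (u (l c)) ^+ 2)^-1).
  have [l4 {}L4] : exists l4, is_derive (rc t) (1 : C) G l4 by eexists; exact: L4.
  have [L7 _] := is_derive_re (is_deriveZ (82 * m) L4).
  have : {for t, continuous (fun x : R => re ((82 * m) *: G (rc x)))}.
    by apply: differentiable_continuous; exact/derivable1_diffP.
  have E x : (82 * m) *: G (rc x) = sg (tt x) (u (l (rc x))) (v (l (rc x))) * m.
    rewrite /sg /G /GRing.scale /=; ring.
  have -> : (fun x : R => re ((82 * m) *: G (rc x))) =
      (fun x : R => re (sg (tt x) (u (l (rc x))) (v (l (rc x))) * m)).
    by apply/funext => x; rewrite E.
  exact.
- have D := is_derive_line_translate (F := fun z => hat1 (v z) / hat1 (u z))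
    (ratio_derive w fu fv Ul hl).
  have := is_derive_re D; congr is_derive; congr re.
  rewrite ul vl lsl slice_dlog; last exact: ac.
  rewrite /sig /sg; ring.
Qed.

Let within_re m : {within `[0, 1], continuous (fun t : R => re (sig t * m))}.
Proof.
apply/subspace_continuousP => t t01.
have [f [g [h gc _]]] := segment_local t01.
apply: (cvg_within_near (g := fun t => re (sig t * m)) t01 _ (gc m)).
by apply: filterS h => t' h i; have [_ e] := h i; rewrite e.
Qed.

Lemma segment_sign m :
  (forall t : R, t \in `[0, 1] -> re (sig t * m) != 0) -> 0 < re (sig 0 * m) ->
  forall t : R, t \in `[0, 1] -> 0 < re (sig t * m).
Proof.
move=> n0 p0 t t01; rewrite ltNge; apply/negP => pt.
have /andP[t0 t1] : (0 <= t) && (t <= 1) by move: t01; rewrite in_itv.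
have sub : [set` `[0, t]] `<=` [set` `[0, 1]].
  by move=> x; rewrite /= !in_itv /= => /andP[-> xt]; exact: le_trans t1.
have cw := continuous_subspaceW sub (@within_re m).
have [|c] := IVT (v := 0) t0 cw.
  by rewrite min_r ?max_l ?(le_trans pt (ltW p0)) // pt ltW.
rewrite in_itv /= => /andP[c0 ct] e; have c01 : c \in `[0, 1].
  by rewrite in_itv /= c0 (le_trans ct).
by have /eqP := n0 c c01; apply.
Qed.

Lemma segment_lt : (forall t : R, t \in `[0, 1] -> 0 < re (sig t * d)) ->
  re (hat1 (s 0) / hat1 (r 0)) < re (hat1 (s 1) / hat1 (r 1)).
Proof.
move=> pos; pose g t := re (hat1 (s t) / hat1 (r t)).
have cg : {within `[0, 1], continuous g}.
  apply/subspace_continuousP => t t01.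
  have [f [f' [h _ [df _]]]] := segment_local t01.
  apply: (cvg_within_near (g := g) (h := fun x => re (f x)) t01).
    by apply: filterS h => t' h i; rewrite /g; have [-> _] := h i.
  by apply: differentiable_continuous; exact/derivable1_diffP.
have dg (t : R) : t \in `]0, 1[%R -> is_derive t (1 : R) g (re (sig t * d)).
  move=> t01; have t01' : t \in `[0, 1] by exact: subset_itv_oo_cc.
  have [f [f' [h _ df]]] := segment_local t01'.
  apply: near_eq_is_derive df.
  have h2 := near_in_itvoo t01; apply: filterS2 h h2 => t' h h2.
  have [e _] := h (subset_itv_oo_cc h2); rewrite /g e; exact: erefl.
have [c c01] := MVT ltr01 dg cg.
rewrite subr0 mulr1 => e; rewrite -subr_gt0 e; apply: pos.
exact: subset_itv_oo_cc.
Qed.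

Lemma segment_end : blockf (slice B) (r 1) = 0 /\ hat1 (r 1) != 0.
Proof.
have i1 : (1 : R) \in `[0, 1] by rewrite in_itv /= lexx ler01.
split; last exact: rh.
have := ry i1; congr (blockf (slice _) _ = 0).
by rewrite /tt mul1r addrC subrK.
Qed.

End Segment.
End Slice.

(** * The bow-tie loop *)

Section BowTie.
Context (R : realType).
Local Notation C := (Cx R).
Local Notation V := 'rV[C]_(coinv_dim R).

Lemma imM (z w : C) : im (z * w) = re z * im w + im z * re w.
Proof. by case: z w => [? ?] [? ?]. Qed.
Lemma reD (z w : C) : re (z + w) = re z + re w. Proof. by case: z w => [? ?] [? ?]. Qed.
Lemma imD (z w : C) : im (z + w) = im z + im w. Proof. by case: z w => [? ?] [? ?]. Qed.
Lemma imB (z w : C) : im (z - w) = im z - im w. Proof. by case: z w => [? ?] [? ?]. Qed.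

Lemma nat_rc n : n%:R = rc n%:R :> C. Proof. exact: (esym (rmorph_nat (real_complex R) n)). Qed.
Lemma re_nat n : re (n%:R : C) = n%:R. Proof. by rewrite nat_rc. Qed.
Lemma im_nat n : im (n%:R : C) = 0. Proof. by rewrite nat_rc. Qed.

Lemma eqC (z w : C) : re z = re w -> im z = im w -> z = w.
Proof. by case: z w => [? ?] [? ?]; rewrite /re /im /= => -> ->. Qed.

(** The argument of [v] is less than 30 degrees in absolute value, so the other two cube roots of
    [v^3], turned by 120 degrees, have negative real part. *)
Lemma cube_root_unique (w v : C) : 0 < re w -> 0 < re v ->
  3 * im v ^+ 2 < re v ^+ 2 -> w ^+ 3 = v ^+ 3 -> w = v.
Proof.
move=> w0 v0 vi wv; have : (w - v) * (w * w + w * v + v * v) == 0.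
  rewrite (_ : _ * _ = w ^+ 3 - v ^+ 3); first by rewrite wv subrr.
  by ring.
rewrite mulf_eq0 subr_eq0 => /orP[/eqP//|/eqP e]; exfalso.
have := congr1 (@re R) e; have := congr1 (@im R) e.
rewrite !reD !imD !reM !imM.
move: (re w) (im w) (re v) (im v) w0 v0 vi => x y p q x0 p0 pq.
rewrite (_ : im 0 = 0) // (_ : re 0 = 0) // => e1 e2.
have e3 : y * (2 * x + p) = - q * (x + 2 * p) by lra.
have D0 : 0 < 2 * x + p by lra.
have e4 : (x ^+ 2 + x * p + p ^+ 2) * (2 * x + p) ^+ 2 =
  q ^+ 2 * ((x + 2 * p) ^+ 2 - (x + 2 * p) * (2 * x + p) + (2 * x + p) ^+ 2).
  have -> : x ^+ 2 + x * p + p ^+ 2 = y ^+ 2 + y * q + q ^+ 2 by lra.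
  transitivity ((y * (2 * x + p)) ^+ 2 + (y * (2 * x + p)) * q * (2 * x + p) + q ^+ 2 * (2 * x + p) ^+ 2).
    by ring.
  by rewrite e3; ring.
have e5 : (x + 2 * p) ^+ 2 - (x + 2 * p) * (2 * x + p) + (2 * x + p) ^+ 2 =
   3 * (x ^+ 2 + x * p + p ^+ 2) by ring.
have S0 : 0 < x ^+ 2 + x * p + p ^+ 2.
  by rewrite !addr_gt0 ?exprn_gt0 ?mulr_gt0.
(* If [w] is [v] times a primitive cube root of unity, then [2 re w + re v] is plus or minus
   [sqrt 3 * im v]. *)
have e6 : (2 * x + p) ^+ 2 = 3 * q ^+ 2.
  apply: (mulfI (lt0r_neq0 S0)); rewrite e4 e5; ring.
have : p ^+ 2 < (2 * x + p) ^+ 2.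
  rewrite (_ : (2 * x + p) ^+ 2 = p ^+ 2 + 4 * x * (x + p)); last by ring.
  by rewrite ltrDl !mulr_gt0 // addr_gt0.
by rewrite e6; lra.
Qed.

(* The imaginary part of [m^3 * conj (t^2 - 123^2)], up to sign. *)
Definition cube_im (m t : C) : R :=
  (re m ^+ 3 - 3 * re m * im m ^+ 2) * (2 * re t * im t) -
  (3 * re m ^+ 2 * im m - im m ^+ 3) * (re t ^+ 2 - im t ^+ 2 - 15129).

(** If [w m] is purely imaginary, so is its cube. Multiplying by the squared modulus of [t^2 - q]
    turns that cube into [i k m^3] times the conjugate of [t^2 - q], whose real part must then
    vanish. *)
Lemma re_cube_eq0 (w m t q : C) (k : R) : im q = 0 ->
  w ^+ 3 * (t ^+ 2 - q) = Complex 0 k -> re (w * m) = 0 ->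
  k * ((re m ^+ 3 - 3 * re m * im m ^+ 2) * (2 * re t * im t) -
    (3 * re m ^+ 2 * im m - im m ^+ 3) * (re t ^+ 2 - im t ^+ 2 - re q)) = 0.
Proof.
move=> q0 e wm.
pose cN : C := Complex (re t ^+ 2 - im t ^+ 2 - re q) (- (2 * re t * im t)).
have : (w * m) ^+ 3 * ((t ^+ 2 - q) * cN) = Complex 0 k * m ^+ 3 * cN.
  by rewrite -e; ring.
move/(congr1 (@re R)); move: wm; move: (w * m) => v vm.
have rN : re cN = re t ^+ 2 - im t ^+ 2 - re q by [].
have iN : im cN = - (2 * re t * im t) by [].
have rk : re (Complex 0 k) = 0 by [].
have ik : im (Complex 0 k) = k by [].
move: rN iN rk ik; move: cN (Complex 0 k) => c K rN iN rk ik.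
rewrite !expr2 !exprSr !expr0 !mul1r !(reM, imM, reB, imB) vm rN iN rk ik q0.
move: (re t) (im t) (re m) (im m) (re q) (im v) => t1 t2 x y q1 vi h.
move/eqP: h; rewrite eq_sym -subr_eq0 => /eqP <-.
by ring.
Qed.

Lemma re_cube_neq0 (w m t : C) (k : R) : k != 0 ->
  w ^+ 3 * (t ^+ 2 - 15129) = Complex 0 k -> cube_im m t != 0 -> re (w * m) != 0.
Proof.
move=> k0 e; apply: contraNneq => wm; apply/eqP/(mulfI k0).
by rewrite mulr0 -(re_cube_eq0 (im_nat 15129) e wm) re_nat.
Qed.

(** As long as [cube_im m] is nonzero on the edge, the real part of [sg * m] stays away from 0, and
    its sign survives from [A] to [B]. For [m = B - A] this real part is the derivative of the real
    part of [hat1 s / hat1 r], which therefore grows. *)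
Lemma segment_step (A B : C) (r r' s s' : V) (k : R) :
  KZ_continuation 3 (seg (slice A) (slice B)) r r' ->
  KZ_continuation 3 (seg (slice A) (slice B)) s s' ->
  blockf (slice A) r = 0 -> hat1 r != 0 -> k != 0 ->
  sg A r s ^+ 3 * (A ^+ 2 - 15129) = Complex 0 k ->
  [/\ blockf (slice B) r' = 0, hat1 r' != 0,
    sg B r' s' ^+ 3 * (B ^+ 2 - 15129) = Complex 0 k,
    (forall m, (forall t : R, t \in `[0, 1] -> cube_im m (A + rc t * (B - A)) != 0) ->
      0 < re (sg A r s * m) -> 0 < re (sg B r' s' * m)) &
    (forall t : R, t \in `[0, 1] -> cube_im (B - A) (A + rc t * (B - A)) != 0) ->
      0 < re (sg A r s * (B - A)) -> re (hat1 s / hat1 r) < re (hat1 s' / hat1 r')].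
Proof.
move=> /KZ_continuationP[fr [ar <- <-]] /KZ_continuationP[fs [as_ <- <-]] y0 h0 k0 e.
have [y1 h1] := segment_end ar y0 h0.
have i0 : (0 : R) \in `[0, 1] by rewrite in_itv /= lexx ler01.
have i1 : (1 : R) \in `[0, 1] by rewrite in_itv /= lexx ler01.
have t0 : A + rc 0 * (B - A) = A by rewrite mul0r addr0.
have t1 : A + rc 1 * (B - A) = B by rewrite mul1r addrC subrK.
have cub := segment_sig3 ar as_ y0 h0.
have nz m : (forall t : R, t \in `[0, 1] -> cube_im m (A + rc t * (B - A)) != 0) ->
    forall t : R, t \in `[0, 1] -> re (sg (A + rc t * (B - A)) (fr t) (fs t) * m) != 0.
  by move=> H t t01; apply: re_cube_neq0 k0 _ (H t t01); rewrite cub.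
split.
- exact: y1.
- exact: h1.
- apply: etrans e; apply: etrans (cub 1 i1).
  exact: (congr1 (fun x => sg x (fr 1) (fs 1) ^+ 3 * (x ^+ 2 - 15129)) (esym t1)).
- move=> m H p0; have := segment_sign ar as_ y0 h0 (nz m H) _ i1.
  by rewrite t0 t1; apply.
- move=> H p0; apply: (segment_lt ar as_ y0 h0) => t t01.
  apply: (segment_sign ar as_ y0 h0 (nz _ H)) => //.
  by rewrite t0.
Qed.

Lemma corner (N w c m : C) : N != 0 -> w ^+ 3 * N = c ^+ 3 * N -> 0 < re (w * m) ->
  0 < re (c * m) -> 3 * im (c * m) ^+ 2 < re (c * m) ^+ 2 -> w = c.
Proof.
move=> N0 /(mulIf N0) e wm cm ci.
have : w * m = c * m by apply: cube_root_unique => //; rewrite !exprMn e.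
apply: mulIf; apply: contraTneq wm => ->.
by rewrite mulr0 ltxx.
Qed.

Definition node (x y : R) : C := Complex x y.

Lemma re_node x y : re (node x y) = x. Proof. by []. Qed.
Lemma im_node x y : im (node x y) = y. Proof. by []. Qed.
Lemma re_rc x : re (rc x : C) = x. Proof. by []. Qed.
Lemma im_rc x : im (rc x : C) = 0. Proof. by []. Qed.
Definition reimE := (reD, imD, reM, imM, reB, imB, re_node, im_node, re_rc, im_rc, re_nat, im_nat).

(** On every edge [cube_im] is an affine function of [t * (1 - t)], so this is all that linear
    arithmetic has to know about [t]. *)
Lemma unit_prod (t : R) : t \in `[0, 1] -> 0 <= t * (1 - t).
Proof. by rewrite in_itv /= => /andP[t0 t1]; rewrite mulr_ge0 // subr_ge0. Qed.

Lemma vertical_cube (x : R) (t : R) : x ^+ 2 = 21025 -> t \in `[0, 1] ->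
  cube_im (node x 26 - node x (-26)) (node x (-26) + rc t * (node x 26 - node x (-26))) != 0.
Proof.
move=> x2 /unit_prod t01; apply: lt0r_neq0; rewrite /cube_im !reimE.
rewrite subrr; lra.
Qed.

(** Two directions are required. [B - A] governs the growth along the edge, but at its end
    [sg * (B - A)] falls outside the sector of [cube_root_unique]. Against [-3e + 4i] the end value
    [-e - 3i] of [sg] gives [15 + 5e i], well inside it. *)
Lemma diagonal_cube (e : R) (t : R) : e = 1 \/ e = -1 -> t \in `[0, 1] ->
  let A := node (145 * e) 26 in let B := node (-145 * e) (-26) in
  cube_im (B - A) (A + rc t * (B - A)) != 0 /\
  cube_im (node (-3 * e) 4) (A + rc t * (B - A)) != 0.
Proof.
move=> e1 /unit_prod t01 A B; rewrite /A /B /cube_im !reimE.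
case: e1 => ->; split.
- by apply: ltr0_neq0; lra.
- by apply: lt0r_neq0; lra.
- by apply: ltr0_neq0; lra.
- by apply: lt0r_neq0; lra.
Qed.

Lemma re_sqr (z : C) : re (z ^+ 2) = re z ^+ 2 - im z ^+ 2.
Proof. by rewrite expr2 reM -!expr2. Qed.
Lemma im_sqr (z : C) : im (z ^+ 2) = 2 * re z * im z.
Proof. rewrite expr2 imM; ring. Qed.
Lemma re_cube (z : C) : re (z ^+ 3) = re z ^+ 3 - 3 * re z * im z ^+ 2.
Proof. rewrite exprS reM re_sqr im_sqr; ring. Qed.
Lemma im_cube (z : C) : im (z ^+ 3) = 3 * re z ^+ 2 * im z - im z ^+ 3.
Proof. rewrite exprS imM re_sqr im_sqr; ring. Qed.

(** (1 - 3i)^3 = -26 + 18i and (145 - 26i)^2 - 123^2 = 290 (18 - 26i), with product 290000 i. This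
    is where 123, 145 and 26 come from; conjugation and the sign change of the node give the other
    vertices. *)
Lemma corner_value (x X Y : R) : (X = 145 /\ Y = -26 * x) \/ (X = -145 /\ Y = 26 * x) ->
  x = 1 \/ x = -1 ->
  node x (-3) ^+ 3 * (node X Y ^+ 2 - 15129) = Complex 0 (290 * 1000).
Proof.
move=> h x1; have rq := re_nat 15129; have iq := im_nat 15129.
move: (15129%:R : C) rq iq => q rq iq.
have [k kE] : exists k : R, k = 290 * 1000 by eexists.
rewrite -kE; apply: eqC.
  rewrite reM re_cube im_cube reB imB re_sqr im_sqr rq iq !re_node !im_node.
  case: h => -[-> ->]; case: x1 => ->; lra.
rewrite imM re_cube im_cube reB imB re_sqr im_sqr rq iq !re_node !im_node.
case: h => -[-> ->]; case: x1 => ->.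
all: rewrite kE; lra.
Qed.

Lemma corner_neq0 (w : C) (k : R) N : k != 0 -> w * N = Complex 0 k -> N != 0.
Proof.
move=> k0 e; apply: contraNneq k0 => N0.
by move: e; rewrite N0 mulr0 => -[<-].
Qed.

Lemma node_signs (e : R) : e = 1 \/ e = -1 ->
  [/\ forall x, 0 < re (node e (-3) * (node x 26 - node x (-26))) /\
    3 * im (node e (-3) * (node x 26 - node x (-26))) ^+ 2 <
    re (node e (-3) * (node x 26 - node x (-26))) ^+ 2,
   0 < re (node (- e) (-3) * node (-3 * e) 4) /\
    3 * im (node (- e) (-3) * node (-3 * e) 4) ^+ 2 <
    re (node (- e) (-3) * node (-3 * e) 4) ^+ 2 &
   0 < re (node (- e) (-3) * (node (-145 * e) (-26) - node (145 * e) 26))].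
Proof.
move=> e1; split; [move=> x; split|split|]; rewrite !(reM, imM, reB, imB) !re_node !im_node.
all: rewrite ?subrr; case: e1 => ->; lra.
Qed.

Lemma sqr_145 : (145 : R) ^+ 2 = 21025 /\ (-145 : R) ^+ 2 = 21025.
Proof. by split; lra. Qed.

Lemma corner_values :
  [/\ node 1 (-3) ^+ 3 * (node 145 (-26) ^+ 2 - 15129) = Complex 0 (290 * 1000),
    node (-1) (-3) ^+ 3 * (node 145 26 ^+ 2 - 15129) = Complex 0 (290 * 1000),
    node (-1) (-3) ^+ 3 * (node (-145) (-26) ^+ 2 - 15129) = Complex 0 (290 * 1000) &
    node 1 (-3) ^+ 3 * (node (-145) 26 ^+ 2 - 15129) = Complex 0 (290 * 1000)].
Proof.
have e : 26 = -26 * -1 :> R by rewrite mulrN1 opprK.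
split.
- exact: corner_value (or_introl (conj erefl (esym (mulr1 _)))) (or_introl erefl).
- exact: corner_value (or_introl (conj erefl e)) (or_intror erefl).
- exact: corner_value (or_intror (conj erefl (esym (mulrN1 _)))) (or_intror erefl).
- exact: corner_value (or_intror (conj erefl (esym (mulr1 _)))) (or_introl erefl).
Qed.

(** [sg] is 1 - 3i at 145 - 26i and -145 + 26i, and -1 - 3i at the other two vertices, so its branch
    closes up, while the real part of the ratio grows on each of the four edges. *)
Lemma bow_tie (r0 r1 r2 r3 r4 s0 s1 s2 s3 s4 : V) :
  let P1 := slice (node 145 (-26)) in let P2 := slice (node 145 26) in
  let P3 := slice (node (-145) (-26)) in let P4 := slice (node (-145) 26) in
  [/\ KZ_continuation 3 (seg P1 P2) r0 r1, KZ_continuation 3 (seg P2 P3) r1 r2,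
     KZ_continuation 3 (seg P3 P4) r2 r3 & KZ_continuation 3 (seg P4 P1) r3 r4] ->
  [/\ KZ_continuation 3 (seg P1 P2) s0 s1, KZ_continuation 3 (seg P2 P3) s1 s2,
     KZ_continuation 3 (seg P3 P4) s2 s3 & KZ_continuation 3 (seg P4 P1) s3 s4] ->
  blockf P1 r0 = 0 -> hat1 r0 != 0 -> sg (node 145 (-26)) r0 s0 = node 1 (-3) ->
  [/\ blockf P1 r4 = 0, hat1 r4 != 0, sg (node 145 (-26)) r4 s4 = node 1 (-3) &
    re (hat1 s0 / hat1 r0) < re (hat1 s4 / hat1 r4)].
Proof.
move=> P1 P2 P3 P4 [Cr1 Cr2 Cr3 Cr4] [Cs1 Cs2 Cs3 Cs4] y0 h0 g0.
have k0 : (290 * 1000 : R) != 0 by rewrite mulf_neq0 ?pnatr_eq0.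
have [v1 v2 v3 v4] := corner_values.
have [sq1 sq2] := sqr_145.
have vc1 t := @vertical_cube 145 t sq1.
have vc2 t := @vertical_cube (-145) t sq2.
have [p1 p2 p3] := node_signs (or_introl erefl : 1 = 1 \/ 1 = -1).
have [n1 n2 n3] := node_signs (or_intror erefl : -1 = 1 \/ -1 = -1).
have dg1 t := @diagonal_cube 1 t (or_introl erefl).
have dg2 t := @diagonal_cube (-1) t (or_intror erefl).
rewrite !mulr1 in dg1 p2 p3; rewrite !mulrN1 !opprK in dg2 n2 n3.
have e0 : sg (node 145 (-26)) r0 s0 ^+ 3 * (node 145 (-26) ^+ 2 - 15129) =
    Complex 0 (290 * 1000).
  by rewrite g0.
have [y1 h1 e1 m1 l1] := segment_step Cr1 Cs1 y0 h0 k0 e0.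
rewrite g0 in m1 l1.
have g1 : sg (node 145 26) r1 s1 = node (-1) (-3).
  apply: (corner (corner_neq0 k0 v2) (etrans e1 (esym v2)) _ (n1 145).1 (n1 145).2).
  exact: m1 vc1 (p1 145).1.
have [y2 h2 e2 m2 l2] := segment_step Cr2 Cs2 y1 h1 k0 e1.
rewrite g1 in m2 l2.
have g2 : sg (node (-145) (-26)) r2 s2 = node (-1) (-3).
  apply: (corner (corner_neq0 k0 v3) (etrans e2 (esym v3)) _ p2.1 p2.2).
  exact: m2 (fun t i => (dg1 t i).2) p2.1.
have [y3 h3 e3 m3 l3] := segment_step Cr3 Cs3 y2 h2 k0 e2.
rewrite g2 in m3 l3.
have g3 : sg (node (-145) 26) r3 s3 = node 1 (-3).
  apply: (corner (corner_neq0 k0 v4) (etrans e3 (esym v4)) _ (p1 (-145)).1 (p1 (-145)).2).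
  exact: m3 vc2 (n1 (-145)).1.
have [y4 h4 e4 m4 l4] := segment_step Cr4 Cs4 y3 h3 k0 e3.
rewrite g3 in m4 l4.
have g4 : sg (node 145 (-26)) r4 s4 = node 1 (-3).
  apply: (corner (corner_neq0 k0 v1) (etrans e4 (esym v1)) _ n2.1 n2.2).
  exact: m4 (fun t i => (dg2 t i).2) n2.1.
split; [exact: y4|exact: h4|exact: g4|].
have {}l1 := l1 vc1 (p1 145).1.
have {}l2 := l2 (fun t i => (dg1 t i).1) p3.
have {}l3 := l3 vc2 (n1 (-145)).1.
have {}l4 := l4 (fun t i => (dg2 t i).1) n3.
exact: lt_trans l1 (lt_trans l2 (lt_trans l3 l4)).
Qed.

End BowTie.

(** * Paths that avoid collisions of points *)

Section Paths.
Context (R : realType).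
Local Notation C := (Cx R).

(** Points [j] and [k] meet on the complex line through [z] and [z'] at a single parameter [b j k].
    If that parameter is [t (1/2 + i e)] with [t] real, the ratio of its imaginary part to twice its
    real part is [e]; a large [e] thus excludes all pairs at once. *)
Lemma bent_conf4 (z z' : 'rV[C]_4) : conf4 z -> exists B : R, forall e, B < `|e| ->
  forall t : R, conf4 (z + rc t *: (node 2^-1 e *: (z' - z))).
Proof.
move=> cz.
pose b (j k : 'I_4) : C := - (z 0 j - z 0 k) / ((z' 0 j - z' 0 k) - (z 0 j - z 0 k)).
pose F (p : 'I_4 * 'I_4) : R := `|im (b p.1 p.2) / (2 * re (b p.1 p.2))|.
exists (\sum_p F p) => e he t j k jk; apply/eqP => e0.
have x0 := conf4_neq cz jk.
have F0 p : 0 <= F p by exact: normr_ge0.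
have leF : F (j, k) <= \sum_p F p by rewrite (bigD1 (j, k)) //= lerDl sumr_ge0.
suff : F (j, k) = `|e| by move=> Fe; move: he; rewrite ltNge -Fe leF.
rewrite /F /=.
have bE : b j k = rc t * node 2^-1 e.
  have h : (z 0 j - z 0 k) + rc t * node 2^-1 e * ((z' 0 j - z' 0 k) - (z 0 j - z 0 k)) = 0.
    by move/eqP: e0; rewrite !mxE -subr_eq0 => /eqP <-; ring.
  rewrite /b; move: h x0; move: (z 0 j - z 0 k) (z' 0 j - z' 0 k) => x y h x0.
  have D0 : y - x != 0.
    by apply: contra_neq x0 => D0; move: h; rewrite D0 mulr0 addr0.
  by apply: (mulIf D0); rewrite divfK //; apply/eqP; rewrite eq_sym -addr_eq0 addrC h.
have t0 : t != 0.
  apply: contra_neq x0 => t0; have : b j k = 0 by rewrite bE t0 mul0r.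
  move/eqP; rewrite mulf_eq0 invr_eq0 oppr_eq0 => /orP[/eqP//|/eqP D0].
  move/eqP: e0; rewrite !mxE -subr_eq0 => /eqP.
  rewrite (_ : _ - _ = (z 0 j - z 0 k) + rc t * node 2^-1 e * ((z' 0 j - z' 0 k) - (z 0 j - z 0 k))).
    by rewrite D0 mulr0 addr0.
  ring.
rewrite bE !reimE; congr `|_|; field.
by rewrite t0.
Qed.

Lemma node_onem (e : R) : node 2^-1 (- e) = 1 - node 2^-1 e.
Proof.
have h : 2^-1 = 1 - 2^-1 :> R by lra.
by rewrite {1}h -[- e]sub0r.
Qed.

(** The straight segment may cross a diagonal; the midpoint is pushed far in the imaginary direction
    instead. Seen from [z'], it is the point for [- e], so [bent_conf4] serves both halves. *)
Lemma seg_detour (z z' : 'rV[C]_4) : conf4 z -> conf4 z' ->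
  exists v, (forall t : R, conf4 (seg z v t)) /\ (forall t : R, conf4 (seg v z' t)).
Proof.
move=> cz cz'; have [B1 h1] := bent_conf4 z' cz; have [B2 h2] := bent_conf4 z cz'.
pose e : R := 1 + `|B1| + `|B2|.
have eE : `|e| = e by rewrite ger0_norm // !addr_ge0.
have e1 : B1 < `|e|.
  by rewrite eE /e; have := ler_norm B1; have := normr_ge0 B2; lra.
have e2 : B2 < `|- e|.
  by rewrite normrN eE /e; have := ler_norm B2; have := normr_ge0 B1; lra.
exists (z + node 2^-1 e *: (z' - z)); split=> t.
  by have := h1 e e1 t; rewrite /seg [_ + _ - z]addrAC subrr add0r.
have -> : seg (z + node 2^-1 e *: (z' - z)) z' t =
    z' + rc (1 - t) *: (node 2^-1 (- e) *: (z - z')).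
  have r1 : rc 1 = 1 :> C by [].
  rewrite node_onem /seg rcB r1; move: (rc t) (node 2^-1 e) => T L.
  apply/rowP => j; rewrite !mxE; ring.
exact: h2.
Qed.

Definition path_in (a : R -> 'rV[C]_4) (p q : 'rV[C]_4) : Prop :=
  [/\ {within `[0, 1], continuous a}, forall t : R, t \in `[0, 1] -> conf4 (a t),
    a 0 = p & a 1 = q].

Lemma path_in_seg (p q : 'rV[C]_4) : (forall t : R, t \in `[0, 1] -> conf4 (seg p q t)) ->
  path_in (seg p q) p q.
Proof.
move=> h; split; [exact: continuous_subspaceT (@seg_continuous _ _ _)|exact: h| |].
  by rewrite /seg (_ : rc 0 = 0) // scale0r addr0.
by rewrite /seg (_ : rc 1 = 1) // scale1r addrC subrK.
Qed.

Lemma path_in_pcat a b p q r : path_in a p q -> path_in b q r -> path_in (pcat a b) p r.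
Proof.
move=> [ca aI a0 a1] [cb bI b0 b1]; pose I01 : set R := [set` `[0, 1]]; split.
- apply: (@Defs.within_continuous_glue R _ _ _ id 2^-1 (a \o (fun t => 2 * t)) (b \o (fun t => 2 * t - 1))).
  + exact: interval_closed.
  + by move=> x; exact: cvg_id.
  + apply: (Defs.within_continuous_comp (B := I01) (f := fun t : R => 2 * t) _ _ ca).
      by move=> t []; rewrite /I01 /= !in_itv /= => /andP[? ?] ?; apply/andP; split; lra.
    by apply: continuous_subspaceT => x; apply: cvgM; [exact: cvg_cst|exact: cvg_id].
  + apply: (Defs.within_continuous_comp (B := I01) (f := fun t : R => 2 * t - 1) _ _ cb).
      by move=> t []; rewrite /I01 /= !in_itv /= => /andP[? ?] ?; apply/andP; split; lra.
    by apply: continuous_subspaceT; exact: continuous_affine.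
  + have two : 2 * 2^-1 = 1 :> R by lra.
    by move=> t _ ->; rewrite /= two subrr a1 b0.
- move=> t; rewrite /pcat in_itv /= => /andP[? ?]; case: leP => h.
    by apply: aI; rewrite in_itv /=; apply/andP; split; lra.
  by apply: bI; rewrite in_itv /=; apply/andP; split; lra.
- by rewrite /pcat invr_ge0 ler0n mulr0.
- rewrite /pcat (_ : (1 <= 2^-1 :> R) = false); last by apply/negbTE; rewrite -ltNge; lra.
  by rewrite -b1; congr b; lra.
Qed.

Lemma vertical_conf (x : R) (t : R) : x ^+ 2 = 21025 ->
  conf4 (seg (slice (node x (-26))) (slice (node x 26)) t).
Proof.
move=> x2; rewrite slice_segE; set w : C := _ + _.
have rw : re w = x by rewrite /w !reimE; ring.
have key (y : R) : y ^+ 2 != 21025 -> w != node y 0.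
  move=> y2; apply/eqP => h; move/eqP: y2; apply.
  by rewrite -x2 -rw h re_node.
have n123 : (123 : C) = node 123 0 by rewrite nat_rc.
have n369 : (369 : C) = node 369 0 by rewrite nat_rc.
have nn123 : - (123 : C) = node (-123) 0 by rewrite n123 /node; congr Complex; exact: oppr0.
apply/slice_conf; split.
- by rewrite n123; apply: key; apply/eqP => h; lra.
- by rewrite nn123; apply: key; apply/eqP => h; lra.
- by rewrite n369; apply: key; apply/eqP => h; lra.
Qed.

Lemma diagonal_conf (x : R) (t : R) : x != 0 -> x ^+ 2 = 21025 -> t \in `[0, 1] ->
  conf4 (seg (slice (node x 26)) (slice (node (- x) (-26))) t).
Proof.
move=> x0 x2 t01; rewrite slice_segE; set w : C := _ + _.
have rw : 26 * re w = x * im w by rewrite /w !reimE; ring.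
have key (y : R) : y != 0 -> w != node y 0.
  move=> y0; apply/eqP => h; move/eqP: y0; apply.
  by move: rw; rewrite h re_node im_node mulr0; lra.
have n123 : (123 : C) = node 123 0 by rewrite nat_rc.
have n369 : (369 : C) = node 369 0 by rewrite nat_rc.
have nn123 : - (123 : C) = node (-123) 0 by rewrite n123 /node; congr Complex; exact: oppr0.
apply/slice_conf; split.
- by rewrite n123; apply: key; rewrite pnatr_eq0.
- by rewrite nn123; apply: key; rewrite oppr_eq0 pnatr_eq0.
- by rewrite n369; apply: key; rewrite pnatr_eq0.
Qed.

End Paths.

(** * Monodromy *)

Section FieldIdentities.
Variables (F : fieldType) (x x' : F).
Hypotheses (x0 : x != 0) (x0' : x' != 0).

Lemma ratio_cancel : - (x' / x) * x + x' = 0.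
Proof. by rewrite mulNr divfK // addNr. Qed.

Lemma ratio_eq (a a' : F) : - (x' / x) * a + a' = 0 -> a' / x' = a / x.
Proof.
move/eqP; rewrite addrC mulNr subr_eq0 => /eqP ->.
by rewrite mulrC mulrA mulrA mulVf // mul1r mulrC.
Qed.

Lemma ratio_wronsk (c p y y' w w' : F) : c != 0 -> p * w = x * y -> p * w' = x' * y' ->
  c * (w' / x' ^+ 2) = c * (w / x ^+ 2) -> - (x' / x) * y + y' = 0.
Proof.
move=> c0 e e' /(mulfI c0) h.
have -> : y = p * w / x by rewrite e mulrAC divff ?mul1r.
have -> : y' = p * w' / x' by rewrite e' mulrAC divff ?mul1r.
have -> : w' = w / x ^+ 2 * x' ^+ 2 by rewrite -h divfK ?expf_neq0.
by field; rewrite x0 x0'.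
Qed.

End FieldIdentities.

Section Monodromy.
Context (R : realType).
Local Notation C := (Cx R).
Local Notation V := 'rV[C]_(coinv_dim R).

Lemma hat1_lin (k : C) (u v : V) : hat1 (k *: u + v) = k * hat1 u + hat1 v.
Proof. by rewrite /hat1 mulmxDl -scalemxAl !mxE. Qed.
Lemma hat2_lin (k : C) (u v : V) : hat2 (k *: u + v) = k * hat2 u + hat2 v.
Proof. by rewrite /hat2 mulmxDl -scalemxAl !mxE. Qed.

Lemma hat1Z (k : C) (u : V) : hat1 (k *: u) = k * hat1 u.
Proof. by rewrite /hat1 -scalemxAl mxE. Qed.

Lemma blockf_lin z (k : C) (u v : V) : blockf z (k *: u + v) = k * blockf z u + blockf z v.
Proof. rewrite /blockf hat1_lin hat2_lin; ring. Qed.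

Lemma blockf_wronsk z (r s : V) : plu1 z * wronsk r s = hat1 r * blockf z s - hat1 s * blockf z r.
Proof. rewrite /wronsk /blockf; ring. Qed.

Lemma seg_along_continuous (p q : 'rV[C]_4) : {within `[0, 1], continuous (@seg R p q)}.
Proof. exact: continuous_subspaceT (@seg_continuous _ _ _). Qed.

(* This means [v = 0], as [coinv_dim] is 2, a fact that is never needed. *)
Definition null (v : V) := hat1 v = 0 /\ hat2 v = 0.

Lemma nullP z (v : V) : conf4 z -> blockf z v = 0 -> hat1 v = 0 -> null v.
Proof.
move=> cz; rewrite /blockf => + h; rewrite h mulr0 subr0 => /eqP.
by rewrite mulf_eq0 (negbTE (plu1_neq0 cz)) => /eqP.
Qed.

Lemma blockf_null z (v : V) : null v -> blockf z v = 0.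
Proof. by rewrite /blockf => -[-> ->]; rewrite !mulr0 subr0. Qed.

Lemma KZ_continuation_conf (a : R -> 'rV[C]_4) (v w : V) :
  KZ_continuation 3 a v w -> conf4 (a 0) /\ conf4 (a 1).
Proof.
move=> /KZ_continuationP[s [h _ _]].
by split; apply: KZ_along_conf h _; rewrite in_itv /= lexx ler01.
Qed.

Lemma continuation_block (a : R -> 'rV[C]_4) (v w : V) : {within `[0, 1], continuous a} ->
  KZ_continuation 3 a v w -> blockf (a 0) v = 0 <-> blockf (a 1) w = 0.
Proof.
move=> ca /KZ_continuationP[s [h <- <-]].
have i1 : (1 : R) \in `[0, 1] by rewrite in_itv /= lexx ler01.
have e := along_block ca h i1.
by split => /eqP; [rewrite -e|rewrite e] => /eqP.
Qed.

(** The first integrals act as a uniqueness theorem: conservation of [blockf^2 / disc] preserves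
    membership in the invariant line, and there conservation of the sixth power of [hat1] preserves
    vanishing. *)
Lemma continuation_null (a : R -> 'rV[C]_4) (v w : V) : {within `[0, 1], continuous a} ->
  KZ_continuation 3 a v w -> null v <-> null w.
Proof.
move=> ca cvw; have [c0 c1] := KZ_continuation_conf cvw.
have eb := continuation_block ca cvw.
have key : blockf (a 0) v = 0 -> hat1 v = 0 <-> hat1 w = 0.
  move: cvw => /KZ_continuationP[s [h sv sw]] y0.
  have i1 : (1 : R) \in `[0, 1] by rewrite in_itv /= lexx ler01.
  rewrite -sv in y0; have e := along_hat1 ca h i1 y0; rewrite sv sw in e.
  split=> z; apply/eqP; apply: contraT => n.
    have := mulf_expf_div_neq0 6 n (disc_neq0 c1) (plu1_neq0 c1).
    by rewrite e z expr0n !mul0r eqxx.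
  have := mulf_expf_div_neq0 6 n (disc_neq0 c0) (plu1_neq0 c0).
  by rewrite -e z expr0n !mul0r eqxx.
split=> nv.
  have y0 := blockf_null (a 0) nv.
  exact: nullP c1 (eb.1 y0) ((key y0).1 nv.1).
have y0 := eb.2 (blockf_null (a 1) nv).
exact: nullP c0 y0 ((key y0).2 nv.1).
Qed.

Definition loop_base : 'rV[C]_4 := slice (node 145 (-26)).

Definition bow (v w : V) : Prop := exists v1 v2 v3,
  [/\ KZ_continuation 3 (seg (slice (node 145 (-26))) (slice (node 145 26))) v v1,
   KZ_continuation 3 (seg (slice (node 145 26)) (slice (node (-145) (-26)))) v1 v2,
   KZ_continuation 3 (seg (slice (node (-145) (-26))) (slice (node (-145) 26))) v2 v3 &
   KZ_continuation 3 (seg (slice (node (-145) 26)) (slice (node 145 (-26)))) v3 w].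

Lemma bow_lin k (v w v' w' : V) : bow v w -> bow v' w' -> bow (k *: v + v') (k *: w + w').
Proof.
move=> [v1 [v2 [v3 [a1 a2 a3 a4]]]] [u1 [u2 [u3 [b1 b2 b3 b4]]]].
exists (k *: v1 + u1), (k *: v2 + u2), (k *: v3 + u3).
by split; exact: KZ_continuation_lin.
Qed.

Lemma sg_scale (t k : C) (r s : V) : sg t r (k *: s) = k * sg t r s.
Proof.
have e : k *: s = k *: s + 0 by rewrite addr0.
have h0 : hat1 (0 : V) = 0 by rewrite /hat1 mul0mx mxE.
have h20 : hat2 (0 : V) = 0 by rewrite /hat2 mul0mx mxE.
rewrite /sg /wronsk e hat1_lin hat2_lin h0 h20; ring.
Qed.

Lemma bow_scale k (v w : V) : bow v w -> bow (k *: v) (k *: w).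
Proof.
by move=> h; have := bow_lin (k - 1) h h; rewrite !scalerBl !scale1r !subrK.
Qed.

(** [k] is the factor by which the loop acts on the invariant line. As [sg] returns to its value,
    [wronsk / hat1^2] does too, which forces [blockf] of [s] to be multiplied by the same [k]. The
    growth of the ratio keeps [s' - k s] from being null. *)
Lemma bow_monodromy (r r' s s' : V) : bow r r' -> bow s s' ->
  blockf loop_base r = 0 -> hat1 r != 0 -> blockf loop_base s != 0 ->
  let k := hat1 r' / hat1 r in null (- k *: r + r') /\
    (blockf loop_base (- k *: s + s') = 0 /\ hat1 (- k *: s + s') != 0).
Proof.
move=> br bs y0 h0 ys k.
have cb : conf4 loop_base.
  case: br => v1 [v2 [v3 [/KZ_continuation_conf[+ _] _ _ _]]].
  by rewrite /seg (_ : rc 0 = 0) // scale0r addr0.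
have p0 := plu1_neq0 cb.
have c0 : (290 * 1000 : R) != 0 by rewrite mulf_neq0 ?pnatr_eq0.
have [v1 _ _ _] := corner_values R; have N0 := corner_neq0 c0 v1.
have w0 : wronsk r s != 0.
  have : plu1 loop_base * wronsk r s != 0.
    by rewrite blockf_wronsk y0 mulr0 subr0 mulf_neq0.
  by rewrite mulf_eq0 negb_or => /andP[].
have n82 : (82 : C) != 0 by rewrite pnatr_eq0.
pose g := sg (node 145 (-26)) r s.
have g0 : g != 0.
  exact: mulf_neq0 (mulf_neq0 n82 (invr_neq0 N0)) (mulf_neq0 w0 (invr_neq0 (expf_neq0 2 h0))).
(* [sg] is linear in [s], so a rescaling brings it to the starting value 1 - 3i of [bow_tie]. *)
pose K := node 1 (-3) / g.
have K0 : K != 0.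
  apply: mulf_neq0 (invr_neq0 g0); apply/eqP => /(congr1 (@re R)).
  by apply/eqP; exact: oner_neq0.
have gs : sg (node 145 (-26)) r (K *: s) = node 1 (-3) := etrans (sg_scale _ _ _ _) (divfK g0 _).
have [a1 [a2 [a3 [A1 A2 A3 A4]]]] := br.
have [b1 [b2 [b3 [B1 B2 B3 B4]]]] := bow_scale K bs.
have [y4 h4 g4 lt4] := bow_tie (And4 A1 A2 A3 A4) (And4 B1 B2 B3 B4) y0 h0 gs.
have {}g4 : sg (node 145 (-26)) r' s' = g.
  exact: (mulfI K0 (etrans (esym (sg_scale _ _ _ _)) (etrans g4 (esym (divfK g0 _))))).
split.
  apply: (nullP cb); first by rewrite blockf_lin y0 y4 mulr0 addr0.
  exact: etrans (hat1_lin _ _ _) (ratio_cancel _ h0).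
split.
  have e1 := blockf_wronsk loop_base r s; have e2 := blockf_wronsk loop_base r' s'.
  rewrite y0 mulr0 subr0 in e1; rewrite y4 mulr0 subr0 in e2.
  apply: etrans (blockf_lin _ _ _ _) _.
  have H := ratio_wronsk h0 h4 (mulf_neq0 n82 (invr_neq0 N0)) e1 e2.
  exact: H g4.
(* Were [hat1] to vanish here, the ratio would be the same before and after the loop, and so would
   its multiple by [K], whose real part has grown. *)
apply/eqP => /(etrans (esym (hat1_lin _ _ _)))/(ratio_eq h4) f.
have E : hat1 (K *: s') / hat1 r' = hat1 (K *: s) / hat1 r.
  apply: etrans (congr1 (fun x => x / hat1 r') (hat1Z K s')) _.
  apply: etrans (congr1 (fun x => x / hat1 r) (esym (hat1Z K s))).
  exact: etrans (esym (mulrA _ _ _)) (etrans (congr1 (fun x => K * x) f) (mulrA _ _ _)).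
by move: lt4; rewrite E ltxx.
Qed.

End Monodromy.

(** * Transport to an arbitrary base point and failure of semisimplicity *)

Section NonSemisimple.
Context (R : realType).
Local Notation C := (Cx R).
Local Notation V := 'rV[C]_(coinv_dim R).

Definition bow_path : R -> 'rV[C]_4 :=
  pcat (seg (slice (node 145 (-26))) (slice (node 145 26)))
  (pcat (seg (slice (node 145 26)) (slice (node (-145) (-26))))
  (pcat (seg (slice (node (-145) (-26))) (slice (node (-145) 26)))
  (seg (slice (node (-145) 26)) (slice (node 145 (-26)))))).

(** The bow-tie loop conjugated by the broken path from [z] through [v] to its base point. *)
Definition tour (z v : 'rV[C]_4) : R -> 'rV[C]_4 :=
  pcat (seg z v) (pcat (seg v (loop_base R)) (pcat bow_path
    (pcat (seg (loop_base R) v) (seg v z)))).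

Lemma seg0 (p q : 'rV[C]_4) : seg p q (0 : R) = p.
Proof. by rewrite /seg (_ : rc 0 = 0) // scale0r addr0. Qed.

Lemma seg1 (p q : 'rV[C]_4) : seg p q (1 : R) = q.
Proof. by rewrite /seg (_ : rc 1 = 1) // scale1r addrC subrK. Qed.

Lemma seg_rev (p q : 'rV[C]_4) (t : R) : seg q p t = seg p q (1 - t).
Proof.
have r1 : rc 1 = 1 :> C by [].
by rewrite /seg rcB r1; move: (rc t) => T; apply/rowP => j; rewrite !mxE; ring.
Qed.

Lemma pcat0 (a b : R -> 'rV[C]_4) : pcat a b 0 = a 0.
Proof. by rewrite /pcat invr_ge0 ler0n mulr0. Qed.

Lemma bow_path_in : path_in bow_path (loop_base R) (loop_base R).
Proof.
have [sq1 sq2] := sqr_145 R.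
have n1 : (145 : R) != 0 by rewrite pnatr_eq0.
have n2 : (-145 : R) != 0 by rewrite oppr_eq0.
have d1 (t : R) (i : t \in `[0, 1]) := diagonal_conf n1 sq1 i.
have d2 (t : R) (i : t \in `[0, 1]) := diagonal_conf n2 sq2 i.
rewrite opprK in d2.
apply: path_in_pcat (path_in_seg (fun t _ => vertical_conf t sq1)) _.
apply: path_in_pcat (path_in_seg d1) _.
apply: path_in_pcat (path_in_seg (fun t _ => vertical_conf t sq2)) _.
exact: path_in_seg d2.
Qed.

Lemma tour_in (z v : 'rV[C]_4) : (forall t : R, conf4 (seg z v t)) ->
  (forall t : R, conf4 (seg v (loop_base R) t)) -> path_in (tour z v) z z.
Proof.
move=> h1 h2.
apply: path_in_pcat (path_in_seg (fun t _ => h1 t)) _.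
apply: path_in_pcat (path_in_seg (fun t _ => h2 t)) _.
apply: path_in_pcat bow_path_in _.
apply: (@path_in_pcat _ _ _ _ v).
  by apply: path_in_seg => t _; rewrite seg_rev.
by apply: path_in_seg => t _; rewrite seg_rev.
Qed.

Lemma tour_continuation (z v : 'rV[C]_4) (x y : V) :
  KZ_continuation 3 (tour z v) x y -> exists x1 x2 x3 x4,
  [/\ KZ_continuation 3 (seg z v) x x1, KZ_continuation 3 (seg v (loop_base R)) x1 x2,
    bow x2 x3, KZ_continuation 3 (seg (loop_base R) v) x3 x4 &
    KZ_continuation 3 (seg v z) x4 y].
Proof.
move=> h.
have [|x1 [c1 {}h]] := KZ_continuation_pcat _ h; first by rewrite pcat0 seg0 seg1.
have [_ _ b0 b1] := bow_path_in.
have [|x2 [c2 {}h]] := KZ_continuation_pcat _ h; first by rewrite pcat0 b0 seg1.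
have [|x3 [hb {}h]] := KZ_continuation_pcat _ h; first by rewrite pcat0 seg0 b1.
have [|x4 [c4 c5]] := KZ_continuation_pcat _ h; first by rewrite seg0 seg1.
have [|y1 [e1 {}hb]] := KZ_continuation_pcat _ hb; first by rewrite pcat0 seg0 seg1.
have [|y2 [e2 {}hb]] := KZ_continuation_pcat _ hb; first by rewrite pcat0 seg0 seg1.
have [|y3 [e3 e4]] := KZ_continuation_pcat _ hb; first by rewrite seg0 seg1.
exists x1, x2, x3, x4; split; [exact: c1|exact: c2| |exact: c4|exact: c5].
by exists y1, y2, y3; split; [exact: e1|exact: e2|exact: e3|exact: e4].
Qed.

Lemma nullD (k : C) (u v : V) : null u -> null v -> null (k *: u + v).
Proof.
by move=> [u1 u2] [v1 v2]; split; rewrite (hat1_lin, hat2_lin) (u1, u2) (v1, v2) mulr0 addr0.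
Qed.

Lemma continuation_seg_block (p q : 'rV[C]_4) (v w : V) :
  KZ_continuation 3 (@seg R p q) v w -> blockf p v = 0 <-> blockf q w = 0.
Proof.
move=> h; have := continuation_block (@seg_along_continuous R p q) h.
by rewrite seg0 seg1.
Qed.

Section Tour.
Variables (z v : 'rV[C]_4) (f : V -> V).
Hypotheses (cz : conf4 z) (fE : forall x, KZ_continuation 3 (tour z v) x (f x)).
Hypothesis ct : {within `[0, 1], continuous (tour z v)}.

Lemma tour_monodromy : exists k : C,
  [/\ forall x, blockf z x != 0 -> blockf z (- k *: x + f x) = 0 /\ hat1 (- k *: x + f x) != 0 &
     forall x, blockf z x = 0 -> null (- k *: x + f x)].
Proof.
have p0 := plu1_neq0 cz.
have [l [hl1 hl2]] := Phi_surj (plu1 z) (plu2 z).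
have bl : blockf z l = 0.
  by rewrite /blockf /hat1 /hat2 hl1 hl2 mulrC subrr.
have h10 : hat1 l != 0 by rewrite /hat1 hl1.
have [l1 [r [r' [l4 [a1 a2 a3 a4 a5]]]]] := tour_continuation (fE l).
have ca p q := @seg_along_continuous R p q.
have br : blockf (loop_base R) r = 0.
  exact: (continuation_seg_block a2).1 ((continuation_seg_block a1).1 bl).
have hr : hat1 r != 0.
  apply: contra_neq h10 => r0.
  have cb : conf4 (loop_base R).
    by have [_] := KZ_continuation_conf a2; rewrite seg1.
  have nr := nullP cb br r0.
  exact: ((continuation_null (@ca _ _) a1).2 ((continuation_null (@ca _ _) a2).2 nr)).1.
(* Reversing the outward continuation brings [s] back to [x]; linearity then carries [k *: s + s']
   back to [k *: x + y]. *)
have back x x1 s s' x4 y k : KZ_continuation 3 (seg z v) x x1 ->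
    KZ_continuation 3 (seg v (loop_base R)) x1 s ->
    KZ_continuation 3 (seg (loop_base R) v) s' x4 -> KZ_continuation 3 (seg v z) x4 y ->
    KZ_continuation 3 (seg (loop_base R) v) (k *: s + s') (k *: x1 + x4) /\
    KZ_continuation 3 (seg v z) (k *: x1 + x4) (k *: x + y).
  move=> b1 b2 b4 b5; split; apply: KZ_continuation_lin.
  - by apply: KZ_continuation_rev b2 => t _; exact: seg_rev.
  - exact: b4.
  - by apply: KZ_continuation_rev b1 => t _; exact: seg_rev.
  - exact: b5.
have key x : blockf z x != 0 -> let k := hat1 r' / hat1 r in
    null (- k *: l + f l) /\ (blockf z (- k *: x + f x) = 0 /\ hat1 (- k *: x + f x) != 0).
  move=> bx k.
  have [x1 [s [s' [x4 [b1 b2 b3 b4 b5]]]]] := tour_continuation (fE x).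
  have bs : blockf (loop_base R) s != 0.
    apply: contra_neq bx => bs.
    exact: (continuation_seg_block b1).2 ((continuation_seg_block b2).2 bs).
  have [n1 [n2 n3]] := bow_monodromy a3 b3 br hr bs.
  have [d1 d2] := back _ _ _ _ _ _ (- k) a1 a2 a4 a5.
  have [e1 e2] := back _ _ _ _ _ _ (- k) b1 b2 b4 b5.
  have bx' : blockf z (- k *: x + f x) = 0.
    exact: (continuation_seg_block e2).1 ((continuation_seg_block e1).1 n2).
  split; last split; [|exact: bx'|].
    exact: (continuation_null (@ca _ _) d2).1 ((continuation_null (@ca _ _) d1).1 n1).
  apply: contra_neq n3 => h.
  have nx := nullP cz bx' h.
  exact: ((continuation_null (@ca _ _) e1).2 ((continuation_null (@ca _ _) e2).2 nx)).1.
(* [key] gives its statement about [l] only in the presence of a vector off the invariant line, such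
   as [w]. *)
have [w [hw1 hw2]] := Phi_surj (0 : C) 1.
have bw : blockf z w != 0.
  by rewrite /blockf /hat1 /hat2 hw1 hw2 mulr1 mulr0 subr0.
exists (hat1 r' / hat1 r); split=> [x bx|x bx]; first by have [_] := key x bx.
have [nl _] := key w bw.
(* Up to a null vector, an [x] in the invariant line is the multiple [c *: l]. *)
pose c := hat1 x / hat1 l; pose n := - c *: l + x.
have nn : null n.
  apply: (nullP cz); first by rewrite blockf_lin bl bx mulr0 addr0.
  exact: etrans (hat1_lin _ _ _) (ratio_cancel _ h10).
have nm := (continuation_null ct (KZ_continuation_lin (- c) (fE l) (fE x))).1 nn.
move: nm; set m := _ + f x => nm.
set k := hat1 r' / hat1 r in nl *.
have -> : - k *: x + f x = c *: (- k *: l + f l) + (- k *: n + m).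
  rewrite /n /m; apply/rowP => j; rewrite !mxE; ring.
exact: nullD nl (nullD _ nn nm).
Qed.
End Tour.

Section Semisimple.
Variables (z : 'rV[C]_4) (cz : conf4 z) (rho : pi1 (R := R) cz -> 'M[C]_(coinv_dim R)).
Hypothesis rhoE : forall (a : loop conf4 z) (v : V),
  KZ_continuation 3 a v (v *m rho (pi1_class cz a)).

Lemma block_invariant (g : pi1 (R := R) cz) (x : V) :
  blockf z x = 0 -> blockf z (x *m rho g) = 0.
Proof.
move=> bx; rewrite -(reprK g); set a := repr g.
have := continuation_block (@loop_cts _ _ _ _ a) (rhoE a x).
by rewrite loop0 loop1 => h; exact: h.1 bx.
Qed.

Lemma tour_loop : exists (g : pi1 (R := R) cz) (k : C),
  [/\ forall x : V, blockf z x != 0 ->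
        blockf z (- k *: x + x *m rho g) = 0 /\ hat1 (- k *: x + x *m rho g) != 0 &
     forall x : V, blockf z x = 0 -> null (- k *: x + x *m rho g)].
Proof.
have cb : conf4 (loop_base R).
  by have [_ h e _] := bow_path_in; rewrite -e; apply: h; rewrite in_itv /= lexx ler01.
have [v [h1 h2]] := seg_detour cz cb.
have [ct cc c0 c1] := tour_in h1 h2.
pose a := Loop ct cc c0 c1.
have [k hk] := tour_monodromy cz (rhoE a) ct.
by exists (pi1_class cz a), k.
Qed.

Definition block_mx : 'M[C]_(coinv_dim R) :=
  kermx (Phi R *m (\col_(i < 2) (if i == 0 then - plu2 z else plu1 z))).

Lemma block_mxP (x : V) : (x <= block_mx)%MS = (blockf z x == 0).
Proof.
have E : blockf z x = (x *m (Phi R *m (\col_(i < 2) (if i == 0 then - plu2 z else plu1 z)))) 0 0.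
  rewrite mulmxA /blockf /hat1 /hat2; move: (x *m Phi R) => y.
  rewrite mxE 2!big_ord_recl big_ord0 !mxE /=.
  have -> : lift ord0 ord0 = 1 :> 'I_2 by exact: val_inj.
  ring.
rewrite E; apply/sub_kermxP/eqP => [->|h]; first by rewrite mxE.
by apply/matrixP => i j; rewrite !ord1 h mxE.
Qed.

Lemma not_semisimple : ~ semisimple rho.
Proof.
move=> [I [U [irr sumU _]]].
have [g [k [gk1 gk2]]] := tour_loop.
have inv : subrepresentation rho block_mx.
  move=> h; apply/row_subP => i; rewrite row_mul block_mxP.
  apply/eqP/block_invariant/eqP; rewrite -block_mxP; exact: row_sub.
have nullU i (x : V) : (x <= U i)%MS -> null (- k *: x + x *m rho g).
  move=> xU; have [subU U0 minU] := irr i.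
  (* Either the summand meets the invariant subspace trivially, and then the image of [x], which
     lies in both, is zero; or irreducibility puts the summand inside that subspace, where the map
     has null values. *)
  have [cap0|cap0] := eqVneq (U i :&: block_mx)%MS 0.
    have [bx|bx] := eqVneq (blockf z x) 0; first exact: gk2.
    have [by0 _] := gk1 x bx.
    have : ((- k *: x + x *m rho g)%R <= U i :&: block_mx)%MS.
      rewrite sub_capmx; apply/andP; split; last by rewrite block_mxP by0.
      apply: addmx_sub; first exact: scalemx_sub xU.
      exact: submx_trans (submxMr _ xU) (subU g).
    rewrite cap0 submx0 => /eqP ->.
    by split; rewrite /hat1 /hat2 mul0mx mxE.
  apply: gk2; apply/eqP; rewrite -block_mxP; apply: submx_trans xU _.
  apply: submx_trans (capmxSr (U i) block_mx); apply: minU => //; last exact: capmxSl.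
  move=> h; rewrite sub_capmx; apply/andP; split.
    exact: submx_trans (submxMr _ (capmxSl _ _)) (subU h).
  exact: submx_trans (submxMr _ (capmxSr _ _)) (inv h).
(* The image of this [w], off the invariant line, has nonzero [hat1], whereas decomposing [w] along
   the summands would make it vanish. *)
have [w [hw1 hw2]] := Phi_surj (0 : C) 1.
have bw : blockf z w != 0.
  by rewrite /blockf /hat1 /hat2 hw1 hw2 mulr1 mulr0 subr0 plu1_neq0.
have [_ /eqP] := gk1 w bw; apply.
have : (w <= \sum_i U i)%MS by rewrite (eqmxP sumU) submx1.
move=> /sub_sumsmxP[u ->].
have := fun i => nullU i _ (submxMl (u i) (U i)).
move=> h.
have -> : - k *: (\sum_i u i *m U i) + (\sum_i u i *m U i) *m rho g =
    \sum_i (- k *: (u i *m U i) + u i *m U i *m rho g).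
  by rewrite big_split /= scaler_sumr mulmx_suml.
rewrite /hat1 mulmx_suml summxE big1 // => i _.
by have [] := h i.
Qed.

End Semisimple.
End NonSemisimple.

Theorem proposition128 (R : realType) (z0 : 'rV[Cx R]_4) (z0_conf : conf4 z0)
    (rho : pi1 (R := R) z0_conf -> 'M[Cx R]_(coinv_dim R))
    (rho_KZ : is_KZ_monodromy 3 rho) :
  ~ semisimple rho.
Proof. by case: rho_KZ => _ /not_semisimple. Qed.
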